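(* Let $d \ge 4$ and $g, h \in \{1, \ldots, d-1\}$ with $g < h$. Define $\gamma_{h,g}$ on $\mathcal{S}^d(1)$ by \[ \gamma_{h,g}(S) := \min_{H \in \mathcal{F}_h(S)} \max_{G \in \mathcal{F}_g(H)} \operatorname{vol}_{\mathbb{Z}}(G). \] Then there exists $l$ with either $1 \le l \le 2 + \log_2(\log_2 e + \log_2(d+1))$ or $l = h$ such that $T^d_{1,l}$ maximizes $\gamma_{h,g}$ over $\mathcal{S}^d(1)$.
   Context: The Sylvester sequence: $s_1 = 2$, $s_i = \prod_{j=1}^{i-1} s_j + 1$ for $i \ge 2$. $\mathcal{S}^d(1)$: $d$-dimensional simplices in $\mathbb{R}^d$ with integral vertices and exactly one interior integral point. $\mathcal{F}_h(S)$: set of $h$-dimensional faces. $\operatorname{vol}_{\mathbb{Z}}(F) := \operatorname{vol}_i(F)/\det(\mathbb{Z}^d \cap \operatorname{lin}\{x-y:x,y\in F\})$ for an $i$-dimensional rational polytope $F$. For $j \in \{1,\ldots,d+1\}$, $T^d_{1,j} := \operatorname{conv}(\{0, s_1 e_1, \ldots, s_{j-1} e_{j-1}, (d-j+2)(s_j-1)e_j, \ldots, (d-j+2)(s_j-1) e_d\})$. *)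

(* Defs.v *)
From Stdlib Require Import Reals.
From Stdlib Require Import ClassicalEpsilon.
From HB Require Import structures.
From mathcomp Require Import all_boot all_order all_algebra.
Set Implicit Arguments. Unset Strict Implicit. Unset Printing Implicit Defensive.
Import Order.TTheory GRing.Theory Num.Theory.

Definition log2R (x : Rdefinitions.R) : Rdefinitions.R :=
  Rdefinitions.Rdiv (Rpower.ln x) (Rpower.ln (IZR 2)).

Definition small_index (d l : nat) : Prop :=
  (1 <= l)%N /\
  Rdefinitions.Rle (INR l)
    (Rdefinitions.Rplus (IZR 2)
       (log2R (Rdefinitions.Rplus (log2R (Rtrigo_def.exp (IZR 1)))
                                  (log2R (Rdefinitions.Rplus (INR d) (IZR 1)))))).

Local Open Scope ring_scope.

(* sylv_seq n = [:: s_1; ...; s_n], with s_i = prod_{j<i} s_j + 1 *)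
Fixpoint sylv_seq (n : nat) : seq nat :=
  match n with
  | 0 => [::]
  | n'.+1 => rcons (sylv_seq n') ((\prod_(x <- sylv_seq n') x) + 1)%N
  end.
Definition sylv (i : nat) : nat := nth 0%N (sylv_seq i) i.-1.

Section Geometry.
Variable R : rcfType.
Variable d : nat.

Definition toR (z : 'rV[int]_d) : 'rV[R]_d := map_mx (fun x : int => x%:~R) z.

Definition in_conv (V : seq 'rV[R]_d) (x : 'rV[R]_d) : Prop :=
  exists lam : 'I_(size V) -> R,
    (forall i, 0 <= lam i) /\ \sum_i lam i = 1 /\
    x = \sum_i lam i *: nth 0 V i.

Definition eucl_norm (x : 'rV[R]_d) : R := Num.sqrt (\sum_i x 0 i ^+ 2).

Definition in_interior (V : seq 'rV[R]_d) (x : 'rV[R]_d) : Prop :=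
  exists2 eps : R, 0 < eps &
    forall y : 'rV[R]_d, eucl_norm (y - x) < eps -> in_conv V y.

(* a simplex is given by its d+1 integral vertices *)
Definition verts (v : 'I_d.+1 -> 'rV[int]_d) : seq 'rV[R]_d :=
  [seq toR (v i) | i <- enum 'I_d.+1].

Definition affinely_independent (v : 'I_d.+1 -> 'rV[int]_d) : bool :=
  row_free (\matrix_(i < d, j < d) (toR (v (lift ord0 i)) - toR (v ord0)) 0 j).

Definition in_S1 (v : 'I_d.+1 -> 'rV[int]_d) : Prop :=
  affinely_independent v /\
  exists! z : 'rV[int]_d, in_interior (verts v) (toR z).

(* s = [:: w_0; ...; w_k] affinely independent integral points; edge matrix *)
Definition edge_mx (s : seq 'rV[int]_d) : 'M[R]_((size s).-1, d) :=
  \matrix_(j < (size s).-1, c < d)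
     (toR (nth 0 s j.+1) - toR (nth 0 s 0)) 0 c.

Definition euclid_vol (s : seq 'rV[int]_d) : R :=
  Num.sqrt (\det (edge_mx s *m (edge_mx s)^T)) / ((size s).-1)`!%:R.

(* the lattice Z^d ∩ lin{x - y : x, y in conv s} *)
Definition in_lat (s : seq 'rV[int]_d) (z : 'rV[int]_d) : bool :=
  (toR z <= edge_mx s)%MS.

Definition is_lat_basis (s : seq 'rV[int]_d)
    (B : 'M[int]_((size s).-1, d)) : Prop :=
  row_free (map_mx (fun x : int => x%:~R : R) B) /\
  (forall i, in_lat s (row i B)) /\
  (forall z, in_lat s z -> exists c : 'rV[int]_((size s).-1), z = c *m B).

Definition lat_det (s : seq 'rV[int]_d) : R :=
  epsilon (inhabits 0) (fun r : R => exists B : 'M[int]_((size s).-1, d),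
     @is_lat_basis s B /\
     r = Num.sqrt (\det (map_mx (fun x : int => x%:~R : R) B
                         *m (map_mx (fun x : int => x%:~R : R) B)^T))).

Definition volZ (s : seq 'rV[int]_d) : R := euclid_vol s / lat_det s.

(* faces of the simplex v of dimension k <-> vertex subsets of size k+1 *)
Definition face_pts (v : 'I_d.+1 -> 'rV[int]_d) (A : {set 'I_d.+1})
  : seq 'rV[int]_d := [seq v i | i <- enum A].

Definition max_sub (g : nat) (v : 'I_d.+1 -> 'rV[int]_d) (A : {set 'I_d.+1})
  : R :=
  \big[Num.max/0]_(B : {set 'I_d.+1} | (B \subset A) && (#|B| == g.+1))
     volZ (face_pts v B).

(* min over h-faces H; the seed is the value at one particular h-face
   (vertices 0..h), so this is the true minimum over the nonempty set *)
Definition gamma (h g : nat) (v : 'I_d.+1 -> 'rV[int]_d) : R :=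
  \big[Num.min/max_sub g v [set i : 'I_d.+1 | (i <= h)%N]]_(A : {set 'I_d.+1} | #|A| == h.+1)
     max_sub g v A.

End Geometry.

(* coefficient on e_i (i 1-based) *)
Definition T_coef (d j i : nat) : nat :=
  if (i < j)%N then sylv i else ((d.+2 - j) * (sylv j - 1))%N.

Definition T_simplex (d j : nat) (k : 'I_d.+1) : 'rV[int]_d :=
  if unlift ord0 k is Some i then
    \row_(c < d) (if c == i then (T_coef d j i.+1)%:Z else 0)
  else 0.
Arguments T_simplex d j k : clear implicits.

(* Main.v *)
(**
Let [b i / D] be the barycentric coordinates of the interior lattice point of a
simplex [v] in S^d(1), and [x 0 >= x 1 >= ...] their decreasing rearrangement.

Pigeonhole versions of Minkowski's theorem produce a second interior lattice
point unless [\prod_(i < j) x i <= \sum_(j <= i) x i] for all [j], and unless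
[g! volZ(G) <= 1 / \prod_(i in G :\ k) (b i / D)] for every g-face [G] and every
vertex [k] of [G].  On the face [H] spanned by the h+1 largest coordinates the
latter gives [gamma v <= 1 / (g! \prod_(h - g <= i < h) x i)].  The former gives
[\sum_(i < j) x i <= \sum_(i < j) 1 / s_(i+1)] for the Sylvester sequence [s], by
AM-GM and summation by parts.  On the polytope that these linear inequalities
define, [\prod_(h - g <= i < h) x i] is bounded below by its value at the
coordinates of some [T_l] with [1 <= l <= h], and for [T_l] the bound on [gamma]
is attained.  Finally the value for [l + 1] is at least the value for [l] as soon
as [s_l > 2 (d + 1)], which holds for all [l] above the logarithmic threshold.
*)

From Stdlib Require Import Reals Lra Classical_Prop ClassicalEpsilon.
Require Import Defs.
From HB Require Import structures.
From mathcomp Require Import all_boot all_order all_algebra.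
From mathcomp Require Import ring lra zify.
Set Implicit Arguments. Unset Strict Implicit. Unset Printing Implicit Defensive.
Import Order.TTheory GRing.Theory Num.Theory.
Local Open Scope ring_scope.

(** * The Sylvester sequence and the barycentric inequalities *)

Lemma sylv_seqE n : sylv_seq n = [seq sylv i.+1 | i <- iota 0 n].
Proof.
elim: n => // n IHn.
have sz : size (sylv_seq n) = n by rewrite IHn size_map size_iota.
rewrite -[in RHS]addn1 iotaD map_cat add0n -IHn cats1 /=; congr rcons.
by rewrite /sylv /= nth_rcons sz ltnn eqxx.
Qed.

Lemma sylvS n : sylv n.+1 = (\prod_(0 <= i < n) sylv i.+1).+1.
Proof.
have sz : size (sylv_seq n) = n by rewrite sylv_seqE size_map size_iota.
rewrite {1}/sylv /= nth_rcons sz ltnn eqxx addn1 sylv_seqE big_map.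
by rewrite /index_iota subn0.
Qed.

Lemma sylvSS n : sylv n.+2 = ((sylv n.+1).-1 * sylv n.+1).+1.
Proof. by rewrite sylvS big_nat_recr //= [in RHS]sylvS /= -sylvS. Qed.

Lemma sylv_gt1 n : (1 < sylv n.+1)%N.
Proof.
rewrite sylvS ltnS; elim: n => [|n IHn]; first by rewrite big_nil.
by rewrite big_nat_recr //= muln_gt0 IHn sylvS.
Qed.

Lemma dvdn_sylv i n : (i < n)%N -> (sylv i.+1 %| (sylv n.+1).-1)%N.
Proof.
move=> lin; rewrite [sylv n.+1]sylvS /= (big_cat_nat (n := i)) //=; last exact: ltnW.
by rewrite [in X in (_ * X)%N]big_ltn // mulnCA dvdn_mulr.
Qed.

(** Since [s_(k+1) - 1 = (s_k - 1) s_k >= (s_k - 1)^2], the exponent doubles at each step. This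
    growth is the source of the double logarithm in the threshold. *)
Lemma sylv_double_exp n : (2 ^ (2 ^ n) <= (sylv n.+2).-1)%N.
Proof.
elim: n => [|n IHn]; first by rewrite sylvSS sylvS big_nil.
rewrite sylvSS /= expnSr expnM -mulnn.
by apply: leq_mul => //; apply: leq_trans IHn (leq_pred _).
Qed.

Section RealInequalities.
Variable F : realFieldType.
Implicit Types x u w c : nat -> F.

(** Telescoping: [1 / s = 1 / (s - 1) - 1 / (s (s - 1))], and the last denominator is the next term
    minus 1. *)
Lemma sum_inv_sylv n :
  \sum_(0 <= i < n) (sylv i.+1)%:R^-1 = 1 - ((sylv n.+1).-1)%:R^-1 :> F.
Proof.
elim: n => [|n IHn]; first by rewrite sylvS !big_nil invr1 subrr.
rewrite big_nat_recr //= IHn sylvSS /=; have := sylv_gt1 n.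
case: (sylv n.+1) => [|[|m]] //= _; rewrite natrM -[m.+2%:R]natr1.
have m0 : m.+1%:R != 0 :> F by rewrite pnatr_eq0.
have m1 : m.+1%:R + 1 != 0 :> F by rewrite natr1 pnatr_eq0.
by move: (m.+1%:R) m0 m1 => q q0 q1; field; rewrite q0 q1.
Qed.

(** Summation by parts: replacing every weight by the last, smallest one does not increase the
    weighted sum. *)
Lemma abel_prefix n w x :
    (forall i, (i < n)%N -> 0 <= w i) ->
    (forall i, (i.+1 < n)%N -> w i.+1 <= w i) ->
    (forall k, (k <= n)%N -> 0 <= \sum_(0 <= i < k) x i) ->
  0 <= \sum_(0 <= i < n) w i * x i.
Proof.
case: n => [|n] w0 wdec xs; first by rewrite big_nil.
suff H k : (k <= n)%N ->
    w k * \sum_(0 <= i < k.+1) x i <= \sum_(0 <= i < k.+1) w i * x i.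
  by apply: le_trans (H n _) => //; rewrite mulr_ge0 ?w0 ?xs.
elim: k => [|k IHk] lkn; first by rewrite !big_nat1.
rewrite big_nat_recr //= [leRHS]big_nat_recr //= mulrDr lerD2r.
apply: le_trans (IHk (ltnW lkn)); apply: ler_wpM2r; first exact/xs/ltnW.
exact: wdec.
Qed.

Lemma abel_suffix n w x :
    (forall i, (i < n)%N -> 0 <= w i) ->
    (forall i, (i.+1 < n)%N -> w i <= w i.+1) ->
    (forall k, (k <= n)%N -> 0 <= \sum_(k <= i < n) x i) ->
  0 <= \sum_(0 <= i < n) w i * x i.
Proof.
move=> w0 winc xs; rewrite big_nat_rev /= add0n.
apply: (@abel_prefix n (fun i => w (n - i.+1)%N) (fun i => x (n - i.+1)%N)).
- by move=> i lin; apply: w0; lia.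
- move=> i lin; have -> : (n - i.+1 = (n - i.+2).+1)%N by lia.
  by apply: winc; lia.
move=> k lkn; have := xs (n - k)%N (leq_subr _ _).
suff -> : \sum_(n - k <= i < n) x i = \sum_(0 <= i < k) x (n - i.+1)%N by [].
rewrite big_nat_rev /= -{1}[(n - k)%N]add0n big_addn subKn //.
by apply: eq_big_nat => i /andP[_ lik]; congr x; lia.
Qed.

Lemma AGM_nat (a b : nat) (E : nat -> F) :
    (forall i, (a <= i < b)%N -> 0 <= E i) ->
    \sum_(a <= i < b) E i <= (b - a)%:R ->
  \prod_(a <= i < b) E i <= 1.
Proof.
move=> E0; case: (ltnP a b) => [lab|lba] sE; last by rewrite big_geq.
move: sE; rewrite -{1 3}[a]add0n !big_addn !big_mkord.
have n0 : (0 < b - a)%N by rewrite subn_gt0.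
set n := (b - a)%N => sE.
have Ei (i : 'I_n) : 0 <= E (i + a)%N by apply: E0; have := ltn_ord i; lia.
have := leif_AGM (A := predT) (E := fun i : 'I_n => E (i + a)%N) (fun i _ => Ei i).
rewrite cardE size_enum_ord => -[AG _]; apply: le_trans AG _.
have nF : 0 < n%:R :> F by rewrite ltr0n.
apply: exprn_ile1; last by rewrite ler_pdivrMr // mul1r.
by rewrite divr_ge0 ?sumr_ge0 // ltW.
Qed.

Section BarycentricBound.
(* [x] lists the barycentric coordinates in decreasing order, from index 0. *)
Variables (d : nat) (x : nat -> F).
Hypothesis x_gt0 : forall i, (i <= d)%N -> 0 < x i.
Hypothesis x_dec : forall i j, (i <= j <= d)%N -> x j <= x i.
Hypothesis x_sum1 : \sum_(0 <= i < d.+1) x i = 1.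
Hypothesis prod_le_sum : forall j, (j <= d)%N ->
  \prod_(0 <= i < j) x i <= \sum_(j <= i < d.+1) x i.

(** Take the first [j] where the bound fails. All tails of [x - u] on [[0, j)] are then nonnegative,
    so summation by parts with the increasing weights [1 / x i] bounds the average of [u i / x i] by
    1, and AM-GM gives [\prod u <= \prod x]. But [\prod u = 1 - \sum u] exceeds [1 - \sum x], the
    remaining tail of [x], against [prod_le_sum]. *)
Lemma sum_le_sum_inv_sylv j : (j <= d)%N ->
  \sum_(0 <= i < j) x i <= \sum_(0 <= i < j) (sylv i.+1)%:R^-1.
Proof.
pose u i : F := (sylv i.+1)%:R^-1.
have u0 i : 0 < u i by rewrite invr_gt0 ltr0n ltnW ?sylv_gt1.
rewrite -/(u _); elim/ltn_ind: j => j IHj ljd.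
rewrite leNgt; apply/negP => ltux.
have tails k : (k <= j)%N -> 0 <= \sum_(k <= i < j) (x i - u i).
  rewrite leq_eqVlt => /predU1P[->|lkj]; first by rewrite big_geq.
  have := IHj k lkj (leq_trans (ltnW lkj) ljd).
  rewrite (big_cat_nat (n := k)) ?(ltnW lkj) //= in ltux.
  rewrite [ltRHS](big_cat_nat (n := k)) ?(ltnW lkj) //= in ltux.
  rewrite sumrB; lra.
have xp i : (i < j)%N -> 0 < x i by move=> lij; apply: x_gt0; lia.
have sge0 : 0 <= \sum_(0 <= i < j) (x i)^-1 * (x i - u i).
  apply: abel_suffix tails => [i lij|i lij]; first by rewrite invr_ge0 ltW ?xp.
  rewrite lef_pV2 ?posrE ?xp ?(ltnW lij) //.
  by apply: x_dec; lia.
have : \prod_(0 <= i < j) (u i / x i) <= 1.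
  apply: AGM_nat => [i /andP[_ lij]|]; first by rewrite divr_ge0 ?ltW ?xp.
  rewrite -subr_ge0 subn0; apply: le_trans sge0 _.
  rewrite (eq_big_nat _ _ (F2 := fun i => 1 - u i / x i)); last first.
    by move=> i /andP[_ lij]; rewrite mulrBr mulVf ?gt_eqF ?xp // mulrC.
  by rewrite sumrB big_const_nat subn0 iter_addr_0.
rewrite prodf_div ler_pdivrMr ?mul1r; last first.
  by rewrite big_nat prodr_gt0 // => i /andP[_ /xp].
have -> : \prod_(0 <= i < j) u i = 1 - \sum_(0 <= i < j) u i.
  rewrite /u sum_inv_sylv opprB addrC subrK prodfV sylvS /=.
  by rewrite natr_prod.
move=> H; have := prod_le_sum ljd.
have := x_sum1; rewrite (big_cat_nat (n := j)) //=; last exact: leqW.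
move=> s1; lra.
Qed.

(* Barycentric coordinates of the interior point of [T_simplex d l]; the one at
   the vertex 0 is listed last, at index [d]. *)
Definition Tbary l i : F := ((T_coef d l i.+1)%:R)^-1.

(* By AM-GM it suffices to find [l] for which the linear functional with the
   weights [c i = 1 / x i] on [a, h) is at most its value [h - a] at [x].  That
   functional decreases along [T_1, T_2, ...] as long as [c] stays below its
   average [A] over the remaining coordinates; [k] is where this stops. *)
Lemma exists_Tbary_prod_le a h : (a < h)%N -> (h < d)%N ->
  exists2 l, (1 <= l <= h)%N &
    \prod_(a <= i < h) Tbary l i <= \prod_(a <= i < h) x i.
Proof.
move=> lah lhd.
pose c i : F := if (a <= i < h)%N then (x i)^-1 else 0.
pose C k := \sum_(k <= i < d.+1) c i.
pose A k := C k / (d.+1 - k)%:R.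
have c_ge0 i : 0 <= c i.
  rewrite /c; case: ifP => // /andP[_ lih]; rewrite invr_ge0 ltW // x_gt0 //; lia.
have c_inc i j : (i <= j < h)%N -> c i <= c j.
  move=> /andP[lij ljh]; rewrite {1}/c; case: ifP => // /andP[lai lih].
  rewrite /c ljh (leq_trans lai lij) /= lef_pV2 ?posrE ?x_gt0 ?x_dec //; lia.
have C_ge0 k : 0 <= C k by apply: sumr_ge0.
have C_S k : (k <= d)%N -> C k = c k + C k.+1.
  by move=> lkd; rewrite /C big_ltn.
have Ch : C h = 0.
  rewrite /C big_nat big1 // => i /andP[lhi _]; rewrite /c ltnNge lhi andbF //.
have np k : (k <= d)%N -> 0 < (d.+1 - k)%:R :> F.
  by move=> lkd; rewrite ltr0n subn_gt0.
(* At [h - 1] a single weight is left, so the average cannot exceed it. *)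
have exk : exists k, A k <= c k.
  exists h.-1; have lh : (h.-1 <= d)%N by lia.
  rewrite /A ler_pdivrMr ?np // C_S // (ltn_predK lah) Ch addr0.
  rewrite ler_peMr // ler1n; lia.
case: (ex_minnP exk) => k Ak kmin.
have lkh : (k < h)%N.
  have : (k <= h.-1)%N; last by lia.
  apply: kmin; have lh : (h.-1 <= d)%N by lia.
  rewrite /A ler_pdivrMr ?np // C_S // (ltn_predK lah) Ch addr0.
  rewrite ler_peMr // ler1n; lia.
have lkd : (k <= d)%N by lia.
have Cn : C k = A k * (d.+1 - k)%:R by rewrite /A divfK ?gt_eqF ?np.
have A_ge0 : 0 <= A k by rewrite divr_ge0 // ltW // np.
(* Discarding a weight below the average does not lower the average, so [c k.-1 < A k.-1] gives
   [c k.-1 <= A k]. *)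
have cA i : (i < k)%N -> c i <= A k.
  move=> lik; have ek : k = k.-1.+1 by lia.
  have : c k.-1 < A k.-1 by rewrite ltNge; apply/negP => /kmin; lia.
  have lk1 : (k.-1 <= d)%N by lia.
  rewrite /A ltr_pdivlMr ?np // C_S // -ek => H.
  apply: (@le_trans _ _ (c k.-1)); first by apply: c_inc; lia.
  rewrite ler_pdivlMr ?np //.
  have en : (d.+1 - k.-1)%:R = (d.+1 - k)%:R + 1 :> F by rewrite natr1; congr _%:R; lia.
  rewrite en in H; lra.
(* As in Chebyshev's sum inequality: [c i - A k] sums to zero over [[k, d]], so [x h.-1] may be
   subtracted from every [x i]. Both factors are then nonnegative for [i < h] and nonpositive for
   [i >= h], where [c i = 0]. *)
have tail : A k * \sum_(k <= i < d.+1) x i <= \sum_(k <= i < d.+1) c i * x i.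
  rewrite -subr_ge0.
  have -> : \sum_(k <= i < d.+1) c i * x i - A k * \sum_(k <= i < d.+1) x i =
            \sum_(k <= i < d.+1) (c i - A k) * (x i - x h.-1).
    rewrite [RHS](eq_bigr (fun i => c i * x i - A k * x i - (c i - A k) * x h.-1));
      last by move=> i _; ring.
    rewrite !sumrB -mulr_suml -mulr_sumr sumrB big_const_nat iter_addr_0.
    by rewrite -/(C k) -mulr_natr Cn subrr mul0r subr0.
  rewrite big_nat; apply: sumr_ge0 => i /andP[lki lid].
  case: (ltnP i h) => lih.
    apply: mulr_ge0; last by rewrite subr_ge0 x_dec //; lia.
    by rewrite subr_ge0; apply: le_trans Ak _; apply: c_inc; rewrite lki.
  rewrite /c ltnNge lih andbF /= sub0r mulNr -mulrN; apply: mulr_ge0 => //.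
  by rewrite oppr_ge0 subr_le0 x_dec //; lia.
pose u i : F := (sylv i.+1)%:R^-1.
have head : 0 <= \sum_(0 <= i < k) (A k - c i) * (u i - x i).
  apply: abel_prefix => [i lik|i lik|j ljk].
  - by rewrite subr_ge0 cA.
  - by rewrite lerD2l lerN2 c_inc //; lia.
  by rewrite sumrB subr_ge0 sum_le_sum_inv_sylv //; lia.
exists k.+1; first by lia.
(* From index [k] on [Tbary k.+1] is constant, so only the average weight [A k] matters there. *)
have sT : \sum_(0 <= i < d.+1) c i * Tbary k.+1 i =
          \sum_(0 <= i < k) c i * u i + A k * (1 - \sum_(0 <= i < k) u i).
  rewrite (big_cat_nat (n := k)) //=; last exact: leqW.
  congr (_ + _).
    by apply: eq_big_nat => i /andP[_ lik]; rewrite /Tbary /T_coef ltnS lik.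
  rewrite (eq_big_nat _ _ (F2 := fun i =>
     c i * (((d.+1 - k)%:R)^-1 * ((sylv k.+1).-1)%:R^-1))); last first.
    move=> i /andP[lki _]; rewrite /Tbary /T_coef ltnS ltnNge lki /=.
    by rewrite subSS subn1 natrM invfM.
  by rewrite -mulr_suml -/(C k) mulrA -/(A k) sum_inv_sylv subKr.
have sx : \sum_(0 <= i < d.+1) c i * x i = (h - a)%:R.
  rewrite (big_cat_nat (n := a)) //=; last by lia.
  rewrite big_nat big1 => [|i /andP[_ lia']]; last by rewrite /c leqNgt lia' mul0r.
  rewrite add0r (big_cat_nat (n := h)) //=; [|by lia|by lia].
  rewrite [X in _ + X]big_nat [X in _ + X]big1 => [|i /andP[lhi _]]; last first.
    by rewrite /c ltnNge lhi andbF mul0r.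
  rewrite addr0 (eq_big_nat _ _ (F2 := fun=> 1)); last first.
    by move=> i lih; rewrite /c lih mulVf // gt_eqF // x_gt0 //; lia.
  by rewrite big_const_nat iter_addr_0.
have Tle : \sum_(a <= i < h) Tbary k.+1 i / x i <= (h - a)%:R.
  rewrite -sx (eq_big_nat _ _ (F2 := fun i => c i * Tbary k.+1 i)); last first.
    by move=> i lih; rewrite /c lih mulrC.
  apply: (@le_trans _ _ (\sum_(0 <= i < d.+1) c i * Tbary k.+1 i)).
    rewrite [leRHS](big_cat_nat (n := a)) //=; last by lia.
    rewrite [X in _ <= _ + X](big_cat_nat (n := h)) //=; [|by lia|by lia].
    rewrite addrCA lerDl addr_ge0 // sumr_ge0 // => i _;
      by rewrite mulr_ge0 // invr_ge0 ler0n.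
  rewrite sT [leRHS](big_cat_nat (n := k)) //=; last exact: leqW.
  have := x_sum1; rewrite (big_cat_nat (n := k)) //=; last exact: leqW.
  move=> xs; move: tail head.
  have -> : \sum_(k <= i < d.+1) x i = 1 - \sum_(0 <= i < k) x i by rewrite -xs addrAC subrr add0r.
  have -> : \sum_(0 <= i < k) (A k - c i) * (u i - x i) =
      A k * \sum_(0 <= i < k) u i - A k * \sum_(0 <= i < k) x i
      + \sum_(0 <= i < k) c i * x i - \sum_(0 <= i < k) c i * u i.
    rewrite !mulr_sumr -sumrB -big_split /= -sumrB.
    by apply: eq_bigr => i _; ring.
  by lra.
have xp i : (a <= i < h)%N -> 0 < x i by move=> lih; apply: x_gt0; lia.
have := AGM_nat _ Tle.
rewrite prodf_div ler_pdivrMr ?mul1r; last first.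
  by rewrite big_nat prodr_gt0.
by apply=> i lih; rewrite divr_ge0 ?invr_ge0 ?ler0n // ltW // xp.
Qed.
End BarycentricBound.
End RealInequalities.

(** * Pigeonhole form of Minkowski's theorem *)

Lemma Posz_sum (I : Type) (r : seq I) (P : pred I) (F : I -> nat) :
  (\sum_(i <- r | P i) F i)%N%:Z = \sum_(i <- r | P i) (F i)%:Z.
Proof. exact: (big_morph Posz PoszD). Qed.

Lemma card_ord_lt N n : (n <= N)%N -> #|[pred k : 'I_N | (k < n)%N]| = n.
Proof.
move=> lnN; rewrite -sum1_card (eq_bigl (fun k : 'I_N => (k < n)%N)) //.
by rewrite -(big_ord_widen _ (fun _ => 1%N) lnN) sum1_card card_ord.
Qed.

(** The sides of the boxes vary with the coordinate. Both boxes are embedded into functions to one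
    ordinal type ['I_N.+1], where they become families whose cardinal is the product of the
    sides. *)
Lemma box_pigeonhole (T U : finType) (m : T -> nat) (n : U -> nat)
    (f : {ffun T -> nat} -> {ffun U -> nat}) :
    (\prod_u n u < \prod_t m t)%N ->
    (forall x : {ffun T -> nat},
       (forall t, (x t < m t)%N) -> forall u, (f x u < n u)%N) ->
  exists x y : {ffun T -> nat}, [/\ forall t, (x t < m t)%N,
    forall t, (y t < m t)%N, x <> y & f x = f y].
Proof.
move=> nm fb.
pose N := maxn (\max_t m t) (\max_u n u).
have mN t : (m t <= N.+1)%N by rewrite leqW // leq_max leq_bigmax.
have nN u : (n u <= N.+1)%N by rewrite leqW // leq_max leq_bigmax orbT.
have card_box (V : finType) (p : V -> nat) : (forall v, (p v <= N.+1)%N) ->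
    #|family (fun v => [pred k : 'I_N.+1 | (k < p v)%N])| = (\prod_v p v)%N.
  move=> pN; rewrite card_family foldrE big_map big_enum /=.
  by apply: eq_bigr => v _; rewrite card_ord_lt.
pose val_ (V : finType) (x : {ffun V -> 'I_N.+1}) : {ffun V -> nat} :=
  [ffun v => nat_of_ord (x v)].
pose A := [pred x in family (fun t => [pred k : 'I_N.+1 | (k < m t)%N])].
have Abox x : x \in A -> forall t, (val_ _ x t < m t)%N.
  by rewrite inE => /familyP xA t; have := xA t; rewrite inE ffunE.
pose F x : {ffun U -> 'I_N.+1} := [ffun u => inord (f (val_ _ x) u)].
have [|/dinjectivePn[x xA [y]]] := boolP (dinjectiveb F A).
  move=> /dinjectiveP/card_in_image cA; move: nm; rewrite ltnNge.
  rewrite -(card_box _ _ nN) -(card_box _ _ mN) -[X in (X <= _)%N]cA => /negP[].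
  apply/subset_leq_card/subsetP => _ /imageP[x xA ->].
  apply/familyP => u; rewrite inE ffunE inordK; first exact/fb/Abox.
  exact: leq_trans (fb _ (Abox _ xA) u) _.
rewrite !inE => /andP[nxy yA] eF.
exists (val_ _ x), (val_ _ y); split; [exact: Abox|exact: Abox| |].
  move=> e; case/negP: nxy; apply/eqP/ffunP => t; apply: val_inj.
  by have /ffunP/(_ t) := e; rewrite !ffunE.
apply/ffunP => u; have /ffunP/(_ u)/(congr1 val) := eF.
by rewrite !ffunE /= !inordK // (leq_trans (fb _ (Abox _ _) u)).
Qed.

(* Minkowski's linear form theorem for the forms [t b_i - D a_i], [i in J],
   with [t = \sum_i a_i]: two points of the box of side lengths [b_i] that have
   the same [key] differ by a vector of the lattice of values. *)
Lemma prod_le_sum_compl (T : finType) (b : T -> nat) (D : nat) (J : {set T}) :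
    (\sum_i b i)%N = D -> (forall i, 0 < b i)%N -> J != setT ->
    (forall (t : int) (a : T -> int), 0 <= t -> \sum_i a i = t ->
       (forall i, 0 < (b i)%:Z + t * (b i)%:Z - D%:Z * a i) ->
       forall i, t * (b i)%:Z = D%:Z * a i) ->
  (D * \prod_(i in J) b i <= D ^ #|J| * \sum_(i in ~: J) b i)%N.
Proof.
move=> sumb b0 JT noint; have [->|[j0 j0J]] := set_0Vmem J.
  rewrite big_set0 cards0 setC0 muln1 mul1n -sumb.
  by apply/eq_leq/eq_bigl => i; rewrite inE.
have /existsP[k0 k0J] : [exists k, k \notin J].
  by rewrite -negb_forall; apply: contra JT => /forallP JA; apply/eqP/setP => i; rewrite inE JA.
set E := (\sum_(i in ~: J) b i)%N.
have sumJ : (\sum_(i in J) b i + E)%N = D.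
  by rewrite -sumb [RHS](bigID (mem J)) /=; congr (_ + _)%N; apply: eq_bigl => i; rewrite inE.
have E0 : (0 < E)%N by rewrite /E (bigD1 k0) ?inE //= addn_gt0 b0.
have D0 : (0 < D)%N by rewrite -sumJ addn_gt0 E0 orbT.
rewrite leqNgt; apply/negP => big.
(* If the inequality fails, the box of sides [b i] has more points than there are keys. The slot
   [j0] of a key holds a residue modulo [E], the other slots in [J] residues modulo [D]. *)
pose m i := if i \in J then b i else 1%N.
pose n i := if i == j0 then E else if i \in J then D else 1%N.
pose s (x : {ffun T -> nat}) := (\sum_(i in J) x i)%N.
pose key (x : {ffun T -> nat}) : {ffun T -> nat} := [ffun i =>
  if i == j0 then (s x %% E)%N else
  if i \in J then ((x i + (s x %/ E) * b i) %% D)%N else 0%N].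
have prod_m : (\prod_i m i = \prod_(i in J) b i)%N by rewrite [RHS]big_mkcond.
have prod_n : (D * \prod_i n i = D ^ #|J| * E)%N.
  rewrite (bigD1 j0) //= {1}/n eqxx mulnCA mulnC; congr (_ * _)%N.
  rewrite (eq_bigr (fun i => if i \in J :\ j0 then D else 1%N)); last first.
    by move=> i ij; rewrite /n !inE (negbTE ij).
  rewrite -big_mkcondr /= (eq_bigl (mem (J :\ j0))) => [|i]; last by rewrite !inE; case: eqP.
  by rewrite prod_nat_const -expnS [in RHS](cardsD1 j0) j0J.
have [||x [y [xm ym nxy kxy]]] := @box_pigeonhole _ _ m n key.
- by rewrite -(ltn_pmul2l D0) prod_n prod_m.
- move=> x xm i; rewrite ffunE /n; case: eqP => // _; first by rewrite ltn_mod.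
  by case: ifP => // _; rewrite ltn_mod.
(* The assumption on lattice vectors concerns [0 <= t] only; swapping the two points achieves
   this. *)
wlog le_q : x y xm ym nxy kxy / (s x %/ E <= s y %/ E)%N.
  move=> W; case: (leqP (s x %/ E) (s y %/ E)) => [|/ltnW] q; first exact: (W x y).
  by apply: (W y x) => //; apply: nesym.
pose t : int := (s y %/ E)%:Z - (s x %/ E)%:Z.
have t0 : 0 <= t by rewrite subr_ge0 lez_nat.
pose q (i : T) : int :=
  ((y i + s y %/ E * b i) %/ D)%:Z - ((x i + s x %/ E * b i) %/ D)%:Z.
have xyq i : i \in J -> i != j0 ->
    (x i)%:Z - (y i)%:Z = t * (b i)%:Z - D%:Z * q i.
  move=> iJ ij; have /ffunP/(_ i) := kxy; rewrite !ffunE (negbTE ij) iJ => e.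
  have := divn_eq (x i + s x %/ E * b i) D; have := divn_eq (y i + s y %/ E * b i) D.
  rewrite /t /q -e; set u := (_ %% _)%N; set v := (_ %/ D)%N; set w := (_ %/ D)%N.
  move=> /(congr1 Posz); rewrite !PoszD !PoszM => e1.
  move=> /(congr1 Posz); rewrite !PoszD !PoszM => e2.
  by rewrite mulrBl mulrBr; lia.
pose S : int := \sum_(i in J | i != j0) q i.
(* The value at [j0] is forced by [\sum_i a i = t]; the relation [xya] at [j0] then follows from the
   known sum over [J]. *)
pose a i : int := if i == j0 then t - S else if i \in J then q i else 0.
have suma : \sum_i a i = t.
  rewrite (bigD1 j0) //= {1}/a eqxx.
  rewrite (eq_bigr (fun i => if i \in J then q i else 0)); last first.
    by move=> i /negbTE ij; rewrite /a ij.
  by rewrite -big_mkcondr /= /S (eq_bigl (fun i => (i != j0) && (i \in J))) ?subrK // => i; rewrite andbC.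
have sxy : \sum_(i in J) ((x i)%:Z - (y i)%:Z) = - t * E%:Z.
  have := congr1 (fun f : {ffun T -> nat} => f j0) kxy; rewrite !ffunE eqxx => e.
  rewrite sumrB -!Posz_sum -/(s x) -/(s y).
  rewrite {1}(divn_eq (s x) E) {1}(divn_eq (s y) E) -e !PoszD !PoszM /t; ring.
have xya i : i \in J -> (x i)%:Z - (y i)%:Z = t * (b i)%:Z - D%:Z * a i.
  move=> iJ; have [->|ij] := eqVneq i j0; last by rewrite xyq // /a (negbTE ij) iJ.
  move: sxy; rewrite (bigD1 j0) //= (eq_bigr (fun i => t * (b i)%:Z - D%:Z * q i)); last first.
    by move=> k /andP[]; apply: xyq.
  rewrite sumrB -!mulr_sumr -/S /a eqxx.
  have : (D%:Z = (b j0)%:Z + \sum_(i in J | i != j0) (b i)%:Z + E%:Z).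
    by rewrite -sumJ (bigD1 j0) //= !PoszD Posz_sum.
  set B := (\sum_(i in J | i != j0) _) => eD.
  rewrite -[_ - _]/(_ - _) => e; have {e} -> : (x j0)%:Z - (y j0)%:Z = - t * E%:Z - (t * B - D%:Z * S).
    by rewrite -e addrK.
  rewrite eD; ring.
have tb i : t * (b i)%:Z = D%:Z * a i.
  apply: noint => // k; case: (boolP (k \in J)) => kJ.
    rewrite -addrA -xya //; have := ym k; rewrite /m kJ; lia.
  have -> : a k = 0.
    by rewrite /a (negbTE kJ); case: eqP kJ => // ->; rewrite j0J.
  have := b0 k; rewrite mulr0 subr0; move=> bk; rewrite ltr_wpDr ?mulr_ge0 //.
(* Outside [J] the coefficient [a k0] vanishes, so [t * b k0 = 0]. *)
have t_eq0 : t = 0.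
  have := tb k0; rewrite /a (negbTE k0J); case: eqP k0J => [->|_ _]; first by rewrite j0J.
  by rewrite mulr0 => /eqP; rewrite mulf_eq0 => /orP[/eqP//|]; have := b0 k0; lia.
case: nxy; apply/ffunP => i; case: (boolP (i \in J)) => iJ.
  by have := xya i iJ; rewrite -tb t_eq0; lia.
by have := xm i; have := ym i; rewrite /m (negbTE iJ); lia.
Qed.

(** * Lattice volume *)

Lemma mulmx_tr_gt0 (R : realFieldType) n (u : 'rV[R]_n) :
  u != 0 -> 0 < (u *m u^T) 0 0.
Proof.
move=> u0; have -> : (u *m u^T) 0 0 = \sum_i u 0 i ^+ 2.
  by rewrite mxE; apply: eq_bigr => i _; rewrite mxE expr2.
have /existsP[i ui] : [exists i, u 0 i != 0].
  rewrite -negb_forall; apply: contra u0 => /forallP ui.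
  by apply/eqP/rowP => i; rewrite mxE; apply/eqP.
rewrite (bigD1 i) //=; apply: ltr_wpDr; first by apply: sumr_ge0 => j _; exact: sqr_ge0.
by rewrite lt_def sqrf_eq0 ui sqr_ge0.
Qed.

(* On the segment from the identity to [B *m B^T] every matrix is positive
   definite, so its determinant has no zero there. *)
Lemma gram_det_gt0 (R : rcfType) m n (B : 'M[R]_(m, n)) :
  row_free B -> 0 < \det (B *m B^T).
Proof.
move=> fB; pose G := B *m B^T.
pose Q : 'M[{poly R}]_m := \matrix_(i, j) ((1 - 'X) * (1%:M i j)%:P + 'X * (G i j)%:P).
have detQ t : (\det Q).[t] = \det ((1 - t)%:M + t *: G).
  rewrite -/(horner_eval t (\det Q)) -det_map_mx; congr (\det _).
  apply/matrixP => i j; rewrite !mxE /= /horner_eval !hornerE.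
  by case: eqP => _; rewrite !hornerE ?mulr1n ?mulr0n ?mulr1 ?mulr0.
rewrite ltNge; apply/negP => G0.
have [] := @poly_ivt _ (- \det Q) 0 1; first exact: ler01.
  rewrite !hornerN !detQ subr0 scale0r addr0 det1 subrr scale1r.
  by rewrite -[0%:M]/(0%:M) raddf0 add0r oppr_le0 ler01 oppr_ge0.
move=> t /andP[t0 t1]; rewrite rootN rootE detQ => /det0P[u u0].
(* Pairing the null vector [u] with itself gives [(1 - t) |u|^2 + t |u B|^2 = 0]. *)
move=> /(congr1 (fun w => (w *m u^T) 0 0)).
rewrite mulmxDr mulmxDl mul_mx_scalar -scalemxAr -!scalemxAl mul0mx.
rewrite /G mulmxA -[X in t *: X]mulmxA -trmx_mul mxE [X in X + _]mxE [X in _ + X]mxE.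
rewrite [RHS]mxE => e.
have uB : u *m B != 0 by rewrite mulmx_free_eq0.
have := mulmx_tr_gt0 u0; have := mulmx_tr_gt0 uB.
move: e; set p := (_ *m _) 0 0; set q := (_ *m _) 0 0 => e q0 p0.
have [t1'|t1'] := eqVneq t 1; first by move: e; rewrite t1'; lra.
have : 0 < (1 - t) * p by rewrite mulr_gt0 // subr_gt0 lt_neqAle t1' t1.
have : 0 <= t * q by rewrite mulr_ge0 // ltW.
lra.
Qed.

Lemma det_gram_mul (F : comNzRingType) g n (M : 'M[F]_g) (B : 'M[F]_(g, n)) :
  \det ((M *m B) *m (M *m B)^T) = \det M ^+ 2 * \det (B *m B^T).
Proof.
by rewrite trmx_mul mulmxA -(mulmxA M) !det_mulmx det_tr mulrAC expr2.
Qed.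

Lemma det_factor_neq0 (R : rcfType) g n (E : 'M[int]_(g, n)) X C :
  row_free (map_mx (intr : int -> R) E) -> E = X *m C -> \det X != 0.
Proof.
move=> fE eE; have : map_mx (intr : int -> R) X \in unitmx.
  rewrite -row_free_unit /row_free eqn_leq rank_leq_row /=.
  by rewrite -{1}(eqP fE) eE map_mxM mxrankM_maxl.
by rewrite unitmxE unitfE det_map_mx intr_eq0.
Qed.

Section LatticeVolume.
Variables (R : rcfType) (d : nat).
Implicit Types s : seq 'rV[int]_d.
Notation mxR := (map_mx (intr : int -> R)).

Definition int_edge_mx s : 'M[int]_((size s).-1, d) :=
  \matrix_(j, c) (nth 0 s j.+1 - nth 0 s 0) 0 c.

Lemma edge_mxE s : edge_mx R s = mxR (int_edge_mx s).
Proof. by apply/matrixP => j c; rewrite !mxE rmorphB. Qed.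

Lemma mxR_inj m n : injective (fun A : 'M[int]_(m, n) => mxR A).
Proof.
move=> A B /matrixP e; apply/matrixP => i j; have := e i j; rewrite !mxE.
exact: intr_inj.
Qed.

(** Smith normal form with the unimodular right factor cut down to its first [g] rows [B]. The right
    inverse [P] records that these rows generate a saturated sublattice. *)
Lemma smith_factorization g (E : 'M[int]_(g, d)) : row_free (mxR E) ->
  exists (L : 'M[int]_g) (D : 'rV[int]_g) (B : 'M[int]_(g, d)) (P : 'M[int]_(d, g)),
  [/\ L \in unitmx, E = L *m diag_mx D *m B & B *m P = 1%:M].
Proof.
move=> fE; have lgd : (g <= d)%N by move: fE; rewrite /row_free => /eqP <-; apply: rank_leq_col.
have [L uL [T uT [D _ eE]]] := int_Smith_normal_form E.
pose w := widen_ord lgd.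
exists L, (\row_i D`_i), (\matrix_(i, c) T (w i) c), (\matrix_(c, j) invmx T c (w j)).
split=> //.
  rewrite eE -!mulmxA; congr (_ *m _); apply/matrixP => i c.
  rewrite mul_diag_mx !mxE (bigD1 (w i)) //= big1 => [|k kw]; last first.
    rewrite !mxE; case: eqP => [ik|_]; last by rewrite mulr0n mul0r.
    by case/eqP: kw; apply: val_inj.
  by rewrite !mxE eqxx mulr1n addr0.
apply/matrixP => i j; have /matrixP/(_ (w i) (w j)) := mulmxV uT.
rewrite !mxE => e; rewrite (_ : (i == j) = (w i == w j)) // -e.
by apply: eq_bigr => k _; rewrite !mxE.
Qed.

(** An integral vector [z] in the real span of [B] equals [(z *m P) *m B], with integral
    coefficients. *)
Lemma lat_basisP s (M : 'M[int]_((size s).-1)) B P :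
    row_free (edge_mx R s) -> int_edge_mx s = M *m B -> B *m P = 1%:M ->
  is_lat_basis R B.
Proof.
move=> fE eE BP; rewrite edge_mxE eE map_mxM in fE.
have uM : mxR M \in unitmx.
  rewrite unitmxE unitfE det_map_mx intr_eq0.
  by apply: (det_factor_neq0 (R := R) _ eE); rewrite eE map_mxM; exact: fE.
have fB : row_free (mxR B).
  rewrite /row_free eqn_leq rank_leq_row /=.
  by rewrite -{1}(eqP fE) mxrankM_maxr.
split=> //; split=> [i|z].
  rewrite /in_lat edge_mxE eE map_mxM (eqmxMfull _ _) ?row_full_unit //.
  by rewrite /toR map_row row_sub.
rewrite /in_lat edge_mxE eE map_mxM => /submxP[u zu]; exists (z *m P).
apply: mxR_inj; rewrite !map_mxM -[map_mx _ z]/(toR R z) zu.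
have BPR : mxR B *m mxR P = 1%:M by rewrite -map_mxM BP map_mx1.
by rewrite -!mulmxA [X in _ = _ *m (_ *m X)]mulmxA BPR mul1mx.
Qed.

(** Two bases differ by an integral matrix of determinant 1 or -1. Hence [lat_det] does not depend
    on the choice made by [epsilon]. *)
Lemma lat_basis_gram s B B' : @is_lat_basis R d s B -> @is_lat_basis R d s B' ->
  \det (mxR B *m (mxR B)^T) = \det (mxR B' *m (mxR B')^T).
Proof.
have trans C C' : @is_lat_basis R d s C -> @is_lat_basis R d s C' ->
    exists K, C' = K *m C.
  move=> [_ [_ span]] [_ [inl _]].
  have [K HK] : exists K : 'I__ -> 'rV[int]_(size s).-1, forall i, row i C' = K i *m C.
    by apply: (fin_all_exists (fun i => span _ (inl i))).
  exists (\matrix_i K i); apply/row_matrixP => i.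
  by rewrite row_mul rowK HK.
move=> bB bB'; have [K eK] := trans _ _ bB bB'; have [K' eK'] := trans _ _ bB' bB.
have KK : K' *m K = 1%:M.
  apply: mxR_inj; have [fB _] := bB; apply: (row_free_inj fB).
  by rewrite -!map_mxM -mulmxA -eK -eK' mul1mx.
have dK : (\det K) ^+ 2 = 1.
  have := congr1 determinant KK; rewrite det_mulmx det1 => e.
  move/(congr1 absz)/eqP: e; rewrite abszM muln_eq1 => /andP[_ /eqP eK1].
  have [->|->] : \det K = 1 \/ \det K = -1 by move: (\det K) eK1 => k; lia.
    exact: expr1n.
  by rewrite sqrrN expr1n.
by rewrite eK map_mxM det_gram_mul det_map_mx -rmorphXn /= dK mul1r.
Qed.

(** The Gram determinant of the lattice basis cancels, and the index of the edge lattice remains. *)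
Lemma volZE s (M : 'M[int]_((size s).-1)) B P :
    row_free (edge_mx R s) -> int_edge_mx s = M *m B -> B *m P = 1%:M ->
  volZ R s = `|\det M|%N%:R / ((size s).-1)`!%:R.
Proof.
move=> fE eE BP; have bB := lat_basisP fE eE BP; have [fB _] := bB.
have G0 := gram_det_gt0 fB.
rewrite /volZ /euclid_vol.
have -> : lat_det R s = Num.sqrt (\det (mxR B *m (mxR B)^T)).
  rewrite /lat_det; set Pr := (fun r : R => _).
  have [B' [bB' ->]] : Pr (epsilon (inhabits 0) Pr).
    by apply: epsilon_spec; exists (Num.sqrt (\det (mxR B *m (mxR B)^T))), B.
  by rewrite (lat_basis_gram bB' bB).
rewrite edge_mxE eE map_mxM det_gram_mul sqrtrM ?sqr_ge0 // sqrtr_sqr.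
set q := Num.sqrt _.
have q0 : q != 0 by rewrite gt_eqF // sqrtr_gt0.
rewrite det_map_mx -intr_norm -abszE -pmulrn.
by rewrite [X in X / q]mulrAC mulfK.
Qed.

(** The rows of [C] lie in the face lattice, so they are integral combinations of a basis and
    [\det X] divides the index. For explicit simplices this spares exhibiting a basis. *)
Lemma volZ_ge s (X : 'M[int]_((size s).-1)) (C : 'M[int]_((size s).-1, d)) :
    row_free (edge_mx R s) -> int_edge_mx s = X *m C ->
  `|\det X|%N%:R / ((size s).-1)`!%:R <= volZ R s.
Proof.
move=> fE eE; have fE' := fE; rewrite edge_mxE in fE'.
have [L [D [B [P [uL eB BP]]]]] := smith_factorization fE'.
rewrite (volZE fE eB BP) ler_wpM2r ?invr_ge0 ?ler0n // ler_nat.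
have uX : mxR X \in unitmx.
  by rewrite unitmxE unitfE det_map_mx intr_eq0; apply: det_factor_neq0 fE' eE.
have [_ [_ span]] := lat_basisP fE eB BP.
have inl i : in_lat R s (row i C).
  rewrite /in_lat edge_mxE eE map_mxM (eqmxMfull _ _) ?row_full_unit //.
  by rewrite /toR map_row row_sub.
have [K HK] : exists K : 'I__ -> 'rV[int]_(size s).-1, forall i, row i C = K i *m B.
  by apply: (fin_all_exists (fun i => span _ (inl i))).
have eC : C = (\matrix_i K i) *m B.
  by apply/row_matrixP => i; rewrite row_mul rowK HK.
have eM : L *m diag_mx D = X *m \matrix_i K i.
  by rewrite -[LHS]mulmx1 -[RHS]mulmx1 -BP !mulmxA -eB eE {1}eC !mulmxA.
have M0 : \det (L *m diag_mx D) != 0 by apply: det_factor_neq0 fE' eB.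
rewrite eM det_mulmx abszM leq_pmulr // absz_gt0.
by move: M0; rewrite eM det_mulmx mulf_eq0 negb_or => /andP[].
Qed.
End LatticeVolume.

(** * Faces and barycentric coordinates *)

Section Faces.
Variables (d : nat) (v : 'I_d.+1 -> 'rV[int]_d) (I : {set 'I_d.+1}) (i0 : 'I_d.+1).
Hypothesis i0I : i0 \in I.
Let s := face_pts v I.
Let e j := nth i0 (enum I) j.

Lemma size_face_pts : size s = #|I|.
Proof. by rewrite size_map -cardE. Qed.

Lemma face_vertex_in j : (j < #|I|)%N -> e j \in I.
Proof. by move=> lj; rewrite -mem_enum mem_nth // -cardE. Qed.

Lemma card_face_gt0 : (0 < #|I|)%N.
Proof. by apply/card_gt0P; exists i0. Qed.

Lemma ltn_face (j : 'I_(size s).-1) : (j.+1 < #|I|)%N.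
Proof. by have := ltn_ord j; have := size_face_pts; lia. Qed.

Lemma row_int_edge_mx (j : 'I_(size s).-1) :
  row j (int_edge_mx s) = v (e j.+1) - v (e 0).
Proof.
apply/rowP => c; rewrite !mxE /s /face_pts !(nth_map i0) -?cardE ?ltn_face //.
exact: card_face_gt0.
Qed.

(** The coefficients on the vertices, of sum zero, of the vector whose coordinates along the edges
    of the face are [u]. *)
Definition edge_bary (S : pzRingType) (u : 'rV[S]_(size s).-1) (i : 'I_d.+1) : S :=
  \sum_j u 0 j * ((i == e j.+1)%:R - (i == e 0)%:R).

Lemma sum_edge_bary (S : pzRingType) (u : 'rV[S]_(size s).-1) : \sum_i edge_bary u i = 0.
Proof.
rewrite exchange_big big1 //= => j _; rewrite -mulr_sumr sumrB.
rewrite (bigD1 (e j.+1)) //= eqxx big1 => [|i /negbTE-> //].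
by rewrite (bigD1 (e 0)) //= eqxx big1 ?subrr ?mulr0 // => i /negbTE->.
Qed.

Lemma edge_bary_out (S : pzRingType) (u : 'rV[S]_(size s).-1) i :
  i \notin I -> edge_bary u i = 0.
Proof.
move=> iI; rewrite /edge_bary big1 // => j _.
case: eqP => [ei|_]; first by rewrite ei face_vertex_in ?ltn_face in iI.
case: eqP => [ei|_]; first by rewrite ei face_vertex_in ?card_face_gt0 in iI.
by rewrite subrr mulr0.
Qed.

Lemma edge_bary_vertex (S : pzRingType) (u : 'rV[S]_(size s).-1) (j : 'I_(size s).-1) :
  edge_bary u (e j.+1) = u 0 j.
Proof.
have neq (a b : nat) : (a < #|I|)%N -> (b < #|I|)%N -> (e a == e b) = (a == b).
  by move=> ha hb; rewrite nth_uniq ?enum_uniq // -cardE.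
rewrite /edge_bary (bigD1 j) //= eqxx neq ?ltn_face ?card_face_gt0 //= subr0 mulr1.
rewrite big1 ?addr0 // => k kj; rewrite !neq ?ltn_face ?card_face_gt0 //=.
rewrite eqSS -[(j == k :> nat)]/(j == k) eq_sym (negbTE kj) subrr mulr0 //.
Qed.

Lemma sum_edge_bary_vec (S : pzRingType) (V : lmodType S) (w : 'I_d.+1 -> V) u :
  \sum_i edge_bary u i *: w i = \sum_j u 0 j *: (w (e j.+1) - w (e 0)).
Proof.
under eq_bigr => i _ do rewrite scaler_suml.
rewrite exchange_big; apply: eq_bigr => j _ /=.
under eq_bigr => i _ do rewrite -scalerA scalerBl.
rewrite -scaler_sumr sumrB; congr (_ *: (_ - _)).
  by rewrite (bigD1 (e j.+1)) //= eqxx scale1r big1 ?addr0 // => i /negbTE->; rewrite scale0r.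
by rewrite (bigD1 (e 0)) //= eqxx scale1r big1 ?addr0 // => i /negbTE->; rewrite scale0r.
Qed.

Lemma mul_int_edge_mx (u : 'rV[int]_(size s).-1) :
  u *m int_edge_mx s = \sum_i edge_bary u i *: v i.
Proof.
rewrite sum_edge_bary_vec mulmx_sum_row.
by apply: eq_bigr => j _; rewrite row_int_edge_mx.
Qed.

(** The zero sum eliminates the coefficient of the base vertex [e 0]. *)
Lemma face_vec_edges (n : 'I_d.+1 -> int) :
    (forall i, i \notin I -> n i = 0) -> \sum_i n i = 0 ->
  \sum_i n i *: v i = (\row_j n (e j.+1)) *m int_edge_mx s.
Proof.
move=> nI n0.
have sumI (V : zmodType) (F : 'I_d.+1 -> V) : (forall i, i \notin I -> F i = 0) ->
    \sum_i F i = F (e 0) + \sum_(j < (size s).-1) F (e j.+1).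
  move=> FI; rewrite (bigID (mem I)) /= [X in _ + X]big1 // addr0.
  rewrite -big_enum (big_nth i0) -cardE -(ltn_predK card_face_gt0) big_mkord.
  rewrite big_ord_recl /=; congr (_ + _).
  by rewrite size_face_pts; apply: eq_bigr.
rewrite sumI; last by move=> i /nI->; rewrite scale0r.
rewrite sumI // in n0.
rewrite mulmx_sum_row [RHS](eq_bigr (fun j : 'I_(size s).-1 =>
   n (e j.+1) *: v (e j.+1) - n (e j.+1) *: v (e 0))); last first.
  by move=> j _; rewrite mxE row_int_edge_mx scalerBr.
rewrite sumrB -scaler_suml addrC; congr (_ + _).
by rewrite -scaleNr; congr (_ *: _); apply/eqP; rewrite -subr_eq0 opprK n0.
Qed.
End Faces.

Section Barycentric.
Variables (R : rcfType) (d : nat) (v : 'I_d.+1 -> 'rV[int]_d).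
Hypothesis free_v : affinely_independent R v.
Notation vR i := (toR R (v i)).

Let A : 'M[R]_d := \matrix_(i < d, j < d) (vR (lift ord0 i) - vR ord0) 0 j.

Lemma row_vertex_mx i : row i A = vR (lift ord0 i) - vR ord0.
Proof. by apply/rowP => c; rewrite !mxE. Qed.

Lemma mul_vertex_mx (u : 'rV[R]_d) :
  u *m A = \sum_i u 0 i *: vR (lift ord0 i) - (\sum_i u 0 i) *: vR ord0.
Proof.
rewrite mulmx_sum_row scaler_suml -sumrB; apply: eq_bigr => i _.
by rewrite row_vertex_mx scalerBr.
Qed.

Lemma bary_free (lam : 'I_d.+1 -> R) :
  \sum_i lam i = 0 -> \sum_i lam i *: vR i = 0 -> forall i, lam i = 0.
Proof.
rewrite !big_ord_recl => l0 lv.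
have /eqP : (\row_i lam (lift ord0 i)) *m A = 0.
  rewrite mul_vertex_mx; under eq_bigr do rewrite mxE.
  under [X in _ - X *: _]eq_bigr do rewrite mxE.
  move/eqP: l0; rewrite addr_eq0 => /eqP l0.
  by rewrite -scaleNr -l0 addrC lv.
rewrite mulmx_free_eq0 // => /eqP/rowP ul.
have ll i : lam (lift ord0 i) = 0 by have := ul i; rewrite !mxE.
move=> i; case: (unliftP ord0 i) => [j ->//|->].
by move: l0; under eq_bigr do rewrite ll; rewrite big1 ?addr0.
Qed.

Lemma bary_inj (lam mu : 'I_d.+1 -> R) :
    \sum_i lam i = \sum_i mu i -> \sum_i lam i *: vR i = \sum_i mu i *: vR i ->
  forall i, lam i = mu i.
Proof.
move=> ls lv i; apply/eqP; rewrite -subr_eq0; apply/eqP.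
apply: (@bary_free (fun i => lam i - mu i)); first by rewrite sumrB ls subrr.
by under eq_bigr do rewrite scalerBl; rewrite sumrB lv subrr.
Qed.

Lemma in_convP x : in_conv (verts R v) x <-> exists lam : 'I_d.+1 -> R,
  [/\ forall i, 0 <= lam i, \sum_i lam i = 1 & x = \sum_i lam i *: vR i].
Proof.
have sz : size (verts R v) = d.+1 by rewrite size_map size_enum_ord.
have nthv (i : 'I_(size (verts R v))) : nth 0 (verts R v) i = vR (cast_ord sz i).
  rewrite (nth_map ord0) ?size_enum_ord -?sz //; congr (toR R (v _)).
  by apply: val_inj; rewrite /= nth_enum_ord // -sz.
have bij : bijective (cast_ord sz).
  by exists (cast_ord (esym sz)) => i; rewrite ?cast_ordK ?cast_ordKV.
split=> [[lam [l0 [l1 ->]]]|[lam [l0 l1 ->]]].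
  exists (fun i => lam (cast_ord (esym sz) i)); split=> //.
    rewrite -l1 (reindex _ (onW_bij _ bij)) /=.
    by apply: eq_bigr => i _; rewrite cast_ordK.
  rewrite [RHS](reindex _ (onW_bij _ bij)) /=.
  by apply: eq_bigr => i _; rewrite nthv cast_ordK.
exists (fun i => lam (cast_ord sz i)); split=> //; split.
  by rewrite -l1 [RHS](reindex _ (onW_bij _ bij)).
rewrite (reindex _ (onW_bij _ bij)) /=.
by apply: eq_bigr => i _; rewrite nthv.
Qed.

Lemma eucl_norm_ge0 (w : 'rV[R]_d) : 0 <= eucl_norm w.
Proof. exact: sqrtr_ge0. Qed.

Lemma eucl_normZ t (w : 'rV[R]_d) : eucl_norm (t *: w) = `|t| * eucl_norm w.
Proof.
rewrite /eucl_norm -sqrtr_sqr -sqrtrM ?sqr_ge0 // mulr_sumr.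
by congr Num.sqrt; apply: eq_bigr => i _; rewrite mxE exprMn.
Qed.

Lemma ler_eucl_norm (w : 'rV[R]_d) j : `|w 0 j| <= eucl_norm w.
Proof.
rewrite -sqrtr_sqr ler_wsqrtr // (bigD1 j) //= lerDl.
by apply: sumr_ge0 => i _; apply: sqr_ge0.
Qed.

(** Points of the hull have nonnegative coordinates. Were [lam i = 0], a short move away from vertex
    [i] would stay in the hull although its coordinate at [i] is [- t]. *)
Lemma interior_pos x : in_interior (verts R v) x -> exists lam : 'I_d.+1 -> R,
  [/\ forall i, 0 < lam i, \sum_i lam i = 1 & x = \sum_i lam i *: vR i].
Proof.
case=> eps eps0 H.
have /in_convP[lam [l0 l1 lx]] : in_conv (verts R v) x.
  by apply: H; rewrite subrr -(scale0r 0) eucl_normZ normr0 mul0r.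
exists lam; split=> // i; rewrite lt_def l0 andbT; apply/negP => /eqP li0.
have [t t0 tN] : exists2 t : R, 0 < t & t * eucl_norm (x - vR i) < eps.
  have := eucl_norm_ge0 (x - vR i); move: (eucl_norm _) => N N0.
  exists (eps / (N + 1)); first by rewrite divr_gt0 // ltr_wpDl.
  by rewrite mulrAC ltr_pdivrMr ?ltr_wpDl // ltr_pM2l // ltrDl.
have /in_convP[mu [m0 m1 mx]] : in_conv (verts R v) (x + t *: (x - vR i)).
  by apply: H; rewrite addrAC subrr add0r eucl_normZ gtr0_norm.
have : mu i = - t.
  rewrite (@bary_inj mu (fun j => (1 + t) * lam j - t * (j == i)%:R)).
  - by rewrite li0 eqxx mulr0 mulr1 sub0r.
  - rewrite m1 sumrB -!mulr_sumr l1 (bigD1 i) //= eqxx big1 => [|j /negbTE->//].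
    by rewrite addr0 !mulr1 addrK.
  - rewrite -mx; under eq_bigr do rewrite scalerBl -!scalerA.
    rewrite sumrB -!scaler_sumr -lx (bigD1 i) //= eqxx big1 => [|j /negbTE->]; last by rewrite scale0r.
    by rewrite addr0 !scale1r scalerDl scale1r scalerBr addrA.
by move=> mt; have := m0 i; rewrite mt oppr_ge0 leNgt t0.
Qed.

Lemma pos_interior (lam : 'I_d.+1 -> R) :
    (forall i, 0 < lam i) -> \sum_i lam i = 1 ->
  in_interior (verts R v) (\sum_i lam i *: vR i).
Proof.
move=> l0 l1; pose K := \sum_i \sum_j `|invmx A j i| + 1.
have uA : A \in unitmx by rewrite -row_free_unit.
(* A positive lower bound for all [lam i], in place of their minimum. *)
pose m := (\sum_i (lam i)^-1)^-1.
have Sl i : (lam i)^-1 <= \sum_i (lam i)^-1.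
  by rewrite (bigD1 i) //= lerDl sumr_ge0 // => j _; rewrite invr_ge0 ltW.
have S0 : 0 < \sum_i (lam i)^-1 by apply: lt_le_trans (Sl ord0); rewrite invr_gt0.
have m0 : 0 < m by rewrite invr_gt0.
have ml i : m <= lam i by rewrite /m -[lam i]invrK lef_pV2 ?posrE ?invr_gt0.
have K0 : 0 < K.
  by rewrite /K ltr_wpDl // sumr_ge0 // => i _; apply: sumr_ge0.
(* With this radius each of the [d] edge coordinates of the displacement is at most [m / (d + 1)],
   so vertex 0, which loses their sum, loses at most [m]. *)
exists (m / (K * d.+1%:R)); first by rewrite divr_gt0 // mulr_gt0 // ltr0n.
move=> y; set w := y - _ => wlt.
pose nu := w *m invmx A.
have nule i : `|nu 0 i| <= m / d.+1%:R.
  have H : `|nu 0 i| <= eucl_norm w * K.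
    rewrite mxE; apply: le_trans (ler_norm_sum _ _ _) _.
    apply: (@le_trans _ _ (\sum_j eucl_norm w * `|invmx A j i|)).
      by apply: ler_sum => j _; rewrite normrM ler_wpM2r // ler_eucl_norm.
    rewrite -mulr_sumr ler_wpM2l ?eucl_norm_ge0 // /K [X in _ <= X + _](bigD1 i) //=.
    by rewrite -addrA lerDl addr_ge0 // sumr_ge0 // => k _; apply: sumr_ge0.
  apply: le_trans H _; rewrite -ler_pdivlMr // -mulrA -invfM [_ * K]mulrC.
  exact: ltW.
have md : m / d.+1%:R <= m by rewrite ler_pdivrMr ?ltr0n // ler_peMr ?ler1n // ltW.
have ey : y = \sum_i lam i *: vR i + nu *m A by rewrite mulmxKV // addrC subrK.
apply/in_convP; exists (fun i => lam i +
   (if unlift ord0 i is Some j then nu 0 j else - \sum_j nu 0 j)); split.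
- move=> i; case: unliftP => [j _|_].
    rewrite -lerBlDr sub0r (le_trans _ (ml i)) // (le_trans _ md) //.
    by rewrite (le_trans _ (nule j)) // -normrN ler_norm.
  rewrite subr_ge0; apply: le_trans (ml i).
  apply: le_trans (ler_norm _) _; apply: le_trans (ler_norm_sum _ _ _) _.
  apply: (@le_trans _ _ (\sum_(j < d) m / d.+1%:R)); first exact: ler_sum.
  rewrite sumr_const card_ord -[_ *+ d]mulr_natr mulrAC ler_pdivrMr ?ltr0n //.
  by rewrite ler_pM2l // ler_nat.
- rewrite big_split /= l1 big_ord_recl unlift_none.
  by under [X in _ + (_ + X)]eq_bigr do rewrite liftK; rewrite addNr addr0.
rewrite ey; under [RHS]eq_bigr do rewrite scalerDl.
rewrite big_split /=; congr (_ + _).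
rewrite mul_vertex_mx [RHS]big_ord_recl unlift_none.
by under [X in _ = _ + X]eq_bigr do rewrite liftK; rewrite scaleNr addrC.
Qed.
End Barycentric.

Lemma eq_of_small_diff (x y : nat) (c D : int) :
  x%:Z - y%:Z = c * D -> (x < `|D|)%N -> (y < `|D|)%N -> x = y.
Proof.
move=> e xD yD; have [c0|c0] := eqVneq c 0; first by move: e; rewrite c0 mul0r; lia.
have : (`|D| <= `|x%:Z - y%:Z|)%N by rewrite e abszM leq_pmull // absz_gt0.
lia.
Qed.

Lemma toR_sum (R : rcfType) d (I : Type) (r : seq I) (a : I -> int) (w : I -> 'rV[int]_d) :
  toR R (\sum_(i <- r) a i *: w i) = \sum_(i <- r) (a i)%:~R *: toR R (w i).
Proof.
elim/big_rec2: _ => [|i y z _ <-]; first exact: map_mx0.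
by rewrite /toR map_mxD map_mxZ.
Qed.

Lemma toRD (R : rcfType) d (y z : 'rV[int]_d) : toR R (y + z) = toR R y + toR R z.
Proof. exact: map_mxD. Qed.

Lemma toRB (R : rcfType) d (y z : 'rV[int]_d) : toR R (y - z) = toR R y - toR R z.
Proof. exact: map_mxB. Qed.

(** * Consequences of having a single interior lattice point *)

Section OneInteriorPoint.
Variables (R : rcfType) (d : nat) (v : 'I_d.+1 -> 'rV[int]_d).
Notation vR i := (toR R (v i)).

(* [b i / D] are the barycentric coordinates of [p], and [bary_unique] expresses
   that [p] is the only interior lattice point. *)
Record bary_data (b : 'I_d.+1 -> nat) (D : nat) (p : 'rV[int]_d) : Prop := BaryData {
  bary_gt0 : forall i, (0 < b i)%N;
  bary_sum : (\sum_i b i)%N = D;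
  bary_point : \sum_i ((b i)%:R / D%:R) *: vR i = toR R p;
  bary_unique : forall (mu : 'I_d.+1 -> R) z, \sum_i mu i = 0 ->
    \sum_i mu i *: vR i = toR R z ->
    (forall i, 0 < (b i)%:R / D%:R + mu i) -> forall i, mu i = 0 }.

(** Cramer's rule provides the common denominator [|\det A|], and vertex 0 receives what is missing
    to 1. If [p + z] has positive coordinates it is an interior lattice point, so [z = 0], and [mu]
    vanishes by affine independence. *)
Lemma S1_bary_data : in_S1 R v -> exists b D p, bary_data b D p.
Proof.
case=> free_v [p [ip uniq_p]].
have [lam [l0 l1 lp]] := interior_pos free_v ip.
pose A : 'M[int]_d := \matrix_(i, j) (v (lift ord0 i) - v ord0) 0 j.
have eA : \matrix_(i < d, j < d) (vR (lift ord0 i) - vR ord0) 0 j = map_mx intr A.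
  by apply/matrixP => i j; rewrite !mxE rmorphB.
have uA : map_mx (intr : int -> R) A \in unitmx by rewrite -eA -row_free_unit.
pose D := `|\det A|%N.
have D0 : (0 < D)%N.
  by rewrite absz_gt0; move: uA; rewrite unitmxE unitfE det_map_mx intr_eq0.
have DR : D%:R != 0 :> R by rewrite pnatr_eq0 -lt0n.
pose k := (p - v ord0) *m \adj A.
have lk i : lam (lift ord0 i) * (\det A)%:~R = (k 0 i)%:~R.
  have e : (\row_i lam (lift ord0 i)) *m map_mx intr A = toR R (p - v ord0).
    rewrite -eA mul_vertex_mx toRB lp [in RHS]big_ord_recl.
    under eq_bigr do rewrite mxE; under [X in _ - X *: _]eq_bigr do rewrite mxE.
    have -> : \sum_(i < d) lam (lift ord0 i) = 1 - lam ord0.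
      by rewrite -l1 big_ord_recl addrAC subrr add0r.
    by rewrite scalerBl scale1r opprB addrA [X in X - _]addrC.
  have := congr1 (fun u => (u *m map_mx intr (\adj A)) 0 i) e.
  rewrite -mulmxA -map_mxM mul_mx_adj -map_mxM map_scalar_mx mul_mx_scalar !mxE => <-.
  by rewrite mulrC.
have int_lam i : {m : int | lam i * D%:R = m%:~R}.
  have lift_int j : {m : int | lam (lift ord0 j) * D%:R = m%:~R}.
    exists (Num.sg (\det A) * k 0 j).
    rewrite rmorphM /= -lk mulrCA -rmorphM -/D; congr (_ * _).
    by rewrite pmulrn /D abszE normrEsg.
  case: (unliftP ord0 i) => [j ->|->]; first exact: lift_int.
  exists (D%:Z - \sum_j sval (lift_int j)).
  rewrite rmorphB /= rmorph_sum /=; move: l1; rewrite big_ord_recl => /(canRL (addrK _)) ->.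
  rewrite mulrBl mul1r mulr_suml; congr (_ - _); apply: eq_bigr => j _.
  by case: (lift_int j).
have nat_lam i : {m : nat | lam i = m%:R / D%:R & (0 < m)%N}.
  have [m em] := int_lam i.
  have m0 : 0 < m by rewrite -(ltr0z R) -em mulr_gt0 // ltr0n.
  exists `|m|%N; last by rewrite absz_gt0 gt_eqF.
  by apply: (canRL (mulfK DR)); rewrite em pmulrn gtz0_abs.
exists (fun i => s2val (nat_lam i)), D, p.
have lamE i : (s2val (nat_lam i))%:R / D%:R = lam i by case: (nat_lam i).
split.
- by move=> i; case: (nat_lam i).
- apply/eqP; rewrite -(eqr_nat R) natr_sum -(inj_eq (mulIf (invr_neq0 DR))).
  rewrite mulr_suml divff //; under eq_bigr do rewrite lamE.
  by rewrite l1.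
- by rewrite lp; apply: eq_bigr => i _; rewrite lamE.
move=> mu z m0 mz mpos.
have ez : z = 0.
  apply/eqP; rewrite -subr_eq0 -[X in X == 0](addrK p) -[X in _ == X](subrr p) subr0.
  apply/eqP; congr (_ - _); rewrite addrC; symmetry; apply: uniq_p.
  rewrite toRD lp -mz -big_split /=.
  under eq_bigr do rewrite -scalerDl.
  apply: pos_interior => // [i|]; first by rewrite -lamE.
  by rewrite big_split /= l1 m0 addr0.
by apply: (bary_free free_v) => //; rewrite mz ez /toR map_mx0.
Qed.

Section BaryConsequences.
Variables (b : 'I_d.+1 -> nat) (D : nat) (p : 'rV[int]_d).
Hypothesis free_v : affinely_independent R v.
Hypothesis bD : bary_data b D p.

Lemma bary_denom_gt0 : (0 < D)%N.
Proof. by rewrite -(bary_sum bD) (bigD1 ord0) //= addn_gt0 (bary_gt0 bD). Qed.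

(** Divided by [D ^ (#|J| + 1)], this compares the product of the barycentric coordinates in [J]
    with the sum of the others. In [prod_le_sum_compl], [t] and [a] encode the lattice vector
    [t p - \sum_i a i v i], whose coefficients [mu] sum to zero. *)
Lemma bary_prod_le_sum (J : {set 'I_d.+1}) : J != setT ->
  (D * \prod_(i in J) b i <= D ^ #|J| * \sum_(i in ~: J) b i)%N.
Proof.
move=> JT; have D0 : 0 < D%:R :> R by rewrite ltr0n bary_denom_gt0.
apply: (prod_le_sum_compl (bary_sum bD) (bary_gt0 bD) JT) => t a t0 sa pos i.
pose mu i : R := t%:~R * ((b i)%:R / D%:R) - (a i)%:~R.
have muE j : mu j * D%:R = (t * (b j)%:Z - D%:Z * a j)%:~R.
  by rewrite /mu rmorphB !rmorphM /= mulrBl mulrA divfK ?gt_eqF // [_ * D%:R]mulrC.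
have mu0 : mu i = 0.
  apply: (bary_unique bD (z := t *: p - \sum_i a i *: v i)).
  - rewrite sumrB -mulr_sumr -mulr_suml -natr_sum (bary_sum bD) divff ?gt_eqF //.
    by rewrite -rmorph_sum /= sa mulr1 subrr.
  - rewrite toRB toR_sum /toR map_mxZ -/(toR R p) -(bary_point bD).
    rewrite scaler_sumr -sumrB; apply: eq_bigr => j _.
    by rewrite scalerBl scalerA.
  move=> j; rewrite -(pmulr_lgt0 _ D0) mulrDl muE divfK ?gt_eqF //.
  by have := pos j; rewrite -(ltr0z R) -addrA rmorphD.
by apply/eqP; rewrite -subr_eq0 -(intr_eq0 R) -muE mu0 mul0r.
Qed.

Lemma face_row_free (I : {set 'I_d.+1}) (k : 'I_d.+1) :
  k \in I -> row_free (edge_mx R (face_pts v I)).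
Proof.
move=> kI; apply: inj_row_free => u uE; apply/rowP => j; rewrite mxE.
rewrite -(edge_bary_vertex kI); apply: (bary_free free_v).
  exact: sum_edge_bary.
rewrite sum_edge_bary_vec; apply: etrans uE.
rewrite edge_mxE mulmx_sum_row; apply: eq_bigr => i _.
by rewrite -map_row (row_int_edge_mx kI) map_mxB.
Qed.

(* Minkowski's theorem on the lattice of the face, in the coordinates
   [i in I :\ k]: [y] runs over representatives of this lattice modulo the
   edges of the face, [o] over the grid points of a translated box. *)
Lemma face_index_le (I : {set 'I_d.+1}) (k : 'I_d.+1) (s := face_pts v I)
    (L : 'M[int]_((size s).-1)) (Dl : 'rV[int]_((size s).-1))
    (B : 'M[int]_((size s).-1, d)) (P : 'M[int]_(d, (size s).-1)) :
    k \in I -> L \in unitmx -> int_edge_mx s = L *m diag_mx Dl *m B ->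
    B *m P = 1%:M ->
  (`|\det (L *m diag_mx Dl)| * \prod_(i in I :\ k) b i <= D ^ #|I :\ k|)%N.
Proof.
move=> kI uL eE BP; set M := L *m diag_mx Dl; set N := `|\det M|%N.
have D0 := bary_denom_gt0; have fE := face_row_free kI.
have M0 : \det M != 0.
  by rewrite edge_mxE in fE; apply: det_factor_neq0 fE eE.
have N0 : (0 < N)%N by rewrite absz_gt0.
have NE : N = (\prod_j `|Dl ord0 j|)%N.
  have L1 : `|\det L|%N = 1%N.
    have := congr1 (fun A => `|\det A|%N) (mulmxV uL).
    by rewrite det_mulmx det1 abszM => /eqP; rewrite muln_eq1 => /andP[/eqP].
  rewrite /N /M det_mulmx abszM L1 mul1n det_diag.
  by rewrite (big_morph absz abszM (erefl _)).
(* The signed adjugate inverts [M] up to the factor [N]. It keeps the coefficients [lam] below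
   integral: they represent [N] times the lattice vector [Y x *m B]. *)
pose Q := Num.sg (\det M) *: \adj M.
have QE : Q *m int_edge_mx s = N%:Z *: B.
  rewrite eE mulmxA -/M /Q -scalemxAl mul_adj_mx -scalemxAl mul_scalar_mx scalerA.
  by rewrite -normrEsg abszE.
rewrite leqNgt; apply/negP => big.
pose T := ('I_(size s).-1 + 'I_d.+1)%type.
(* With [g = #|I :\ k|], the box has [N * N ^ g * \prod b i] points against [(N * D) ^ g] keys. *)
pose m (t : T) := match t with
  | inl j => `|Dl ord0 j|%N
  | inr i => if i \in I :\ k then (N * b i)%N else 1%N end.
pose n (i : 'I_d.+1) := if i \in I :\ k then (N * D)%N else 1%N.
pose Y (x : {ffun T -> nat}) : 'rV[int]_(size s).-1 := \row_j (x (inl j))%:Z.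
pose lam (x : {ffun T -> nat}) i := edge_bary k (Y x *m Q) i.
pose key (x : {ffun T -> nat}) : {ffun 'I_d.+1 -> nat} := [ffun i =>
  if i \in I :\ k then
    `|((D%:Z * lam x i + (x (inr i))%:Z) %% (N * D)%:Z)%Z|%N else 0%N].
have ND0 : (N * D)%:Z != 0 by rewrite eqz_nat -lt0n muln_gt0 N0.
have [||x [y [xm ym nxy kxy]]] := @box_pigeonhole _ _ m n key.
- rewrite big_sumType /= -NE -!big_mkcond /= !big_split /= !prod_nat_const.
  by rewrite mulnCA ltn_pmul2l // expn_gt0 N0.
- move=> x _ i; rewrite ffunE /n; case: ifP => // _.
  by rewrite -ltz_nat gez0_abs ?modz_ge0 // ltz_pmod // ltz_nat muln_gt0 N0.
pose l i := lam x i - lam y i.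
pose q i := ((D%:Z * l i + (x (inr i))%:Z - (y (inr i))%:Z) %/ (N * D)%:Z)%Z.
have lq i : i \in I :\ k ->
    D%:Z * l i + (x (inr i))%:Z - (y (inr i))%:Z = q i * (N * D)%:Z.
  move=> iI; have /ffunP/(_ i) := kxy; rewrite !ffunE iI => e.
  rewrite /q divzK //.
  have /eqP : (D%:Z * lam x i + (x (inr i))%:Z = D%:Z * lam y i + (y (inr i))%:Z %[mod (N * D)%:Z])%Z.
    by have := congr1 Posz e; rewrite !gez0_abs ?modz_ge0.
  rewrite eqz_mod_dvd /l; congr (_ %| _)%Z; ring.
(* A translation by edges of the face; the value at [k] makes the sum zero. *)
pose a i := if i == k then - \sum_(j in I :\ k) q j else if i \in I then q i else 0.
have a_out i : i \notin I -> a i = 0.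
  by move=> iI; rewrite /a (negbTE iI); case: eqP iI => // ->; rewrite kI.
have a_in i : i \in I :\ k -> a i = q i.
  by rewrite !inE /a => /andP[/negbTE-> ->].
have suma : \sum_i a i = 0.
  rewrite (bigID (mem I)) /= [X in _ + X]big1 // addr0 (big_setD1 k) //=.
  rewrite (eq_bigr q) //; first by rewrite /a eqxx addNr.
have suml : \sum_i l i = 0 by rewrite sumrB !sum_edge_bary // subrr.
pose mu i : R := (l i)%:~R / N%:R - (a i)%:~R.
have NR : N%:R != 0 :> R by rewrite pnatr_eq0 -lt0n.
have DR : D%:R != 0 :> R by rewrite pnatr_eq0 -lt0n.
have lamB w : \sum_i lam w i *: v i = N%:Z *: (Y w *m B).
  by rewrite -mul_int_edge_mx // -mulmxA QE -scalemxAr.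
pose z := (Y x - Y y) *m B - \sum_i a i *: v i.
have lB : \sum_i l i *: v i = N%:Z *: ((Y x - Y y) *m B).
  under eq_bigr do rewrite scalerBl.
  by rewrite sumrB !lamB -scalerBr -mulmxBl.
have sum_mu : \sum_i mu i = 0.
  by rewrite sumrB -mulr_suml -!rmorph_sum /= suml suma mul0r subrr.
have mu_z : \sum_i mu i *: vR i = toR R z.
  rewrite toRB toR_sum; under eq_bigr do rewrite scalerBl.
  rewrite sumrB; congr (_ - _).
  under eq_bigr do rewrite mulrC -scalerA.
  rewrite -scaler_sumr -toR_sum lB /toR map_mxZ scalerA.
  by rewrite [X in X *: _](mulVf NR) scale1r.
have mu_in i : i \in I :\ k ->
    mu i = ((y (inr i))%:R - (x (inr i))%:R) / (N%:R * D%:R).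
  move=> iI; rewrite /mu a_in //.
  have := congr1 (intr : int -> R) (lq i iI); move: (l i) (q i) => li qi.
  rewrite PoszM rmorphB rmorphD !rmorphM /= -!pmulrn => e.
  apply: (mulIf (mulf_neq0 NR DR)).
  rewrite mulfVK ?mulf_neq0 // mulrBl -e; field.
  by rewrite NR.
have mu_lt i : i \in I :\ k -> `|mu i| < (b i)%:R / D%:R.
  move=> iI; have := xm (inr i); have := ym (inr i); rewrite /m iI => yi xi.
  rewrite mu_in // normrM normfV [`|_ * D%:R|]ger0_norm -?natrM // ltr_pdivrMr ?ltr0n ?muln_gt0 ?N0 //.
  have -> : (b i)%:R / D%:R * (N * D)%:R = (N * b i)%:R :> R.
    by rewrite !natrM; field; rewrite DR.
  move: xi yi; rewrite -!(ltr_nat R) => xi yi.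
  have := ler0n R (x (inr i)); have := ler0n R (y (inr i)) => y0 x0.
  by rewrite ltr_norml; apply/andP; split; lra.
have mu_out i : i \notin I -> mu i = 0.
  by move=> iI; rewrite /mu a_out // /l /lam !edge_bary_out // subrr mul0r subrr.
have b_pos i : 0 < (b i)%:R / D%:R :> R.
  by rewrite divr_gt0 ?ltr0n ?(bary_gt0 bD).
(* Only [mu k] may be large. According to its sign, [p + z] or [p - z] has positive coordinates, and
   [bary_unique] applies. *)
have mu0 i : mu i = 0.
  have [mk|mk] := leP 0 (mu k).
    apply: (bary_unique bD sum_mu mu_z) => j.
    have [->|jk] := eqVneq j k; first by rewrite ltr_wpDr.
    have [jI|jI] := boolP (j \in I); last by rewrite mu_out // addr0.
    have /mu_lt : j \in I :\ k by rewrite !inE jk.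
    by rewrite ltr_norml => /andP[]; lra.
  apply/eqP; rewrite -oppr_eq0; apply/eqP.
  apply: (@bary_unique _ _ _ bD (fun i => - mu i) (- z)) => [||j].
  - by rewrite sumrN sum_mu oppr0.
  - by under eq_bigr do rewrite scaleNr; rewrite sumrN mu_z /toR map_mxN.
  have [->|jk] := eqVneq j k; first by rewrite ltr_wpDr // oppr_ge0 ltW.
  have [jI|jI] := boolP (j \in I); last by rewrite mu_out // oppr0 addr0.
  have /mu_lt : j \in I :\ k by rewrite !inE jk.
  by rewrite ltr_norml => /andP[]; lra.
have la i : l i = N%:Z * a i.
  apply: (@intr_inj R); rewrite rmorphM /=; have /eqP := mu0 i.
  by rewrite subr_eq0 => /eqP/(canRL (divfK NR)) ->; rewrite mulrC.
have zE : (Y x - Y y) *m B = \sum_i a i *: v i.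
  have NZ : N%:Z != 0 by rewrite eqz_nat -lt0n.
  apply/rowP => c; apply: (mulfI NZ).
  have /rowP/(_ c) := lB; rewrite [RHS]mxE => <-.
  by under eq_bigr do rewrite la -scalerA; rewrite -scaler_sumr mxE.
(* Since [mu] vanishes, the difference of the representatives lies in the edge lattice. In the slot
   [inl j] it is thus a multiple of [Dl ord0 j] of smaller absolute value, hence zero. *)
have Ydvd : Y x - Y y = (\row_j a (nth k (enum I) j.+1)) *m L *m diag_mx Dl.
  rewrite -[LHS]mulmx1 -BP mulmxA zE (face_vec_edges v kI a_out suma) -/s eE.
  by rewrite -!mulmxA BP mulmx1.
case: nxy; apply/ffunP => -[j|i].
  have /rowP/(_ j) := Ydvd; rewrite mul_mx_diag !mxE => e.
  exact: (eq_of_small_diff e (xm (inl j)) (ym (inl j))).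
have [iI|iI] := boolP (i \in I :\ k); last first.
  by have := xm (inr i); have := ym (inr i); rewrite /m (negbTE iI); lia.
have := mu_in i iI; rewrite mu0 => /esym/eqP; rewrite mulf_eq0 invr_eq0 mulf_eq0.
by rewrite (negbTE NR) (negbTE DR) !orbF subr_eq0 eqr_nat => /eqP.
Qed.

Lemma volZ_face_le (I : {set 'I_d.+1}) (k : 'I_d.+1) : k \in I ->
  volZ R (face_pts v I) * \prod_(i in I :\ k) ((b i)%:R / D%:R)
    <= ((#|I|.-1)`!%:R)^-1.
Proof.
move=> kI; have fE := face_row_free kI; have fE' := fE; rewrite edge_mxE in fE'.
have [L [Dl [B [P [uL eB BP]]]]] := smith_factorization fE'.
rewrite (volZE fE eB BP) -(size_face_pts v I) mulrAC.
rewrite -[leRHS]mul1r ler_wpM2r ?invr_ge0 ?ler0n // prodf_div prodr_const.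
have D0 : 0 < D%:R :> R by rewrite ltr0n bary_denom_gt0.
rewrite mulrA ler_pdivrMr ?exprn_gt0 // mul1r -natr_prod -natrM -natrX ler_nat.
exact: face_index_le kI uL eB BP.
Qed.
End BaryConsequences.
End OneInteriorPoint.

(** * The simplices [T_l] *)

(** Greedy choice: the largest element of [Q] is at least [#|Q| - 1]; remove it and continue. *)
Lemma top_subset_prod n (c : nat -> nat) : (forall i j, (i <= j)%N -> (c i <= c j)%N) ->
  forall g (Q : {set 'I_n}), (g <= #|Q|)%N ->
  exists2 Q' : {set 'I_n}, (Q' \subset Q) && (#|Q'| == g) &
    (\prod_(#|Q| - g <= i < #|Q|) c i <= \prod_(i in Q') c i)%N.
Proof.
move=> c_inc; elim=> [|g IHg] Q gQ.
  by exists set0; rewrite ?sub0set ?cards0 // subn0 big_geq // big_set0.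
have [x0 x0Q] : exists x, x \in Q by apply/card_gt0P; apply: leq_trans gQ.
case: (arg_maxnP (fun i : 'I_n => i : nat) x0Q) => x xQ xmax.
have cQ : #|Q| = #|Q :\ x|.+1 by rewrite (cardsD1 x) [x \in Q]xQ.
have Qx : (#|Q :\ x| <= x)%N.
  have : (#|Q| <= x.+1)%N; last by rewrite cQ.
  rewrite -(card_ord_lt (ltn_ord x)); apply/subset_leq_card/subsetP => i iQ.
  by rewrite inE ltnS; apply: xmax.
have [|Q' /andP[Q'Q /eqP cQ'] le] := IHg (Q :\ x); first by rewrite cQ in gQ.
have xQ' : x \notin Q' by apply/negP => /(subsetP Q'Q); rewrite !inE eqxx.
exists (x |: Q'); first rewrite cardsU1 xQ' cQ' eqxx andbT subUset sub1set [x \in Q]xQ.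
  by apply: subset_trans Q'Q _; apply: subD1set.
rewrite big_setU1 //= cQ subSS big_nat_recr ?leq_subr //= mulnC.
by apply: leq_mul => //; apply: c_inc.
Qed.

Section TSimplex.
Variables (R : rcfType) (d k : nat).
Hypothesis lkd : (k < d)%N.
Let l := k.+1.
Let c i := T_coef d l i.+1.
Let m := ((d.+1 - k) * (sylv k.+1).-1)%N.

Lemma T_coef_tail i : (k <= i)%N -> c i = m.
Proof. by move=> lki; rewrite /c /T_coef ltnS ltnNge lki /= subSS subn1. Qed.

Lemma T_tail_gt0 : (0 < m)%N.
Proof. by rewrite muln_gt0 subn_gt0 ltnS (ltnW lkd) /=; have := sylv_gt1 k; lia. Qed.

(** A Sylvester number divides every later one minus 1. In [volZ_T_ge] this makes edges divisible by
    [c i]. *)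
Lemma T_coef_dvd i : (c i %| m)%N.
Proof.
case: (ltnP i k) => [lik|/T_coef_tail-> //].
by rewrite /c /T_coef ltnS lik dvdn_mull // dvdn_sylv.
Qed.

Lemma T_coef_gt0 i : (0 < c i)%N.
Proof. exact: dvdn_gt0 T_tail_gt0 (T_coef_dvd i). Qed.

Lemma T_coef_le i : (c i <= m)%N.
Proof. exact: dvdn_leq T_tail_gt0 (T_coef_dvd i). Qed.

Lemma leq_sylvS i : (sylv i.+1 <= sylv i.+2)%N.
Proof. by rewrite sylvSS; have := sylv_gt1 i; case: (sylv i.+1) => [|[|n]] // _; nia. Qed.

Lemma T_coef_inc i j : (i <= j)%N -> (c i <= c j)%N.
Proof.
elim: j => [|j IHj]; first by rewrite leqn0 => /eqP->.
rewrite leq_eqVlt => /predU1P[->//|lij]; apply: leq_trans (IHj lij) _.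
case: (ltnP j.+1 k) => [ljk|ljk]; last by rewrite [c j.+1]T_coef_tail // T_coef_le.
by rewrite /c /T_coef !ltnS ljk (ltnW ljk) leq_sylvS.
Qed.

Lemma T_simplexE u i : T_simplex d l u 0 i = (u == lift ord0 i)%:Z * (c i)%:Z.
Proof.
rewrite /T_simplex; case: unliftP => [j|] ->.
  rewrite !mxE (inj_eq (@lift_inj _ ord0)) eq_sym /c.
  by case: eqP => [->|_]; rewrite ?mul1r ?mul0r.
by rewrite mxE (negbTE (neq_lift _ _)) mul0r.
Qed.

Lemma T_affinely_independent : affinely_independent R (T_simplex d l).
Proof.
rewrite /affinely_independent; set A := \matrix_(i, j) _.
have -> : A = diag_mx (\row_i (c i)%:R).
  apply/matrixP => i j; rewrite /A mxE [RHS]mxE 3!mxE 2!mxE !T_simplexE.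
  rewrite (negbTE (neq_lift _ _)) mul0r subr0 (inj_eq (@lift_inj _ ord0)).
  by case: eqP => [->|_]; rewrite ?mul1r ?mul0r ?mulr1n ?mulr0n.
rewrite row_free_unit unitmxE unitfE det_diag; apply/prodf_neq0 => i _.
by rewrite mxE pnatr_eq0 -lt0n T_coef_gt0.
Qed.

(** The origin acts as one more tail vertex: the [d + 1 - k] terms [1 / m] add up to
    [1 / (sylv k.+1 - 1)], the deficit of the Sylvester sum. *)
Lemma sum_Tbary : \sum_(i < d) (c i)%:R^-1 + m%:R^-1 = 1 :> R.
Proof.
rewrite -(big_mkord xpredT (fun i => (c i)%:R^-1 : R)) /=.
rewrite -[X in _ + X](_ : ((c d)%:R)^-1 = _); last by rewrite T_coef_tail // ltnW.
rewrite -[LHS]big_nat_recr //= (big_cat_nat (n := k)) //=; last by lia.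
rewrite (eq_big_nat _ _ (F2 := fun i => (sylv i.+1)%:R^-1)); last first.
  by move=> i /andP[_ lik]; rewrite /c /T_coef ltnS lik.
rewrite sum_inv_sylv (eq_big_nat _ _ (F2 := fun i => m%:R^-1)); last first.
  by move=> i /andP[lki _]; rewrite T_coef_tail.
rewrite big_const_nat iter_addr_0 -[_ *+ (d.+1 - k)]mulr_natl /m natrM invfM mulrA divff; last first.
  by rewrite pnatr_eq0 -lt0n; lia.
by rewrite mul1r subrK.
Qed.

Lemma T_combination (lam : 'I_d.+1 -> R) i :
  (\sum_u lam u *: toR R (T_simplex d l u)) 0 i = lam (lift ord0 i) * (c i)%:R.
Proof.
rewrite summxE (bigD1 (lift ord0 i)) //= big1 => [|u ui].
  by rewrite 2!mxE T_simplexE eqxx mul1r addr0.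
by rewrite 2!mxE T_simplexE (negbTE ui) mul0r mulr0.
Qed.

(** The interior point is the all-ones vector. Interior lattice points have all coordinates at least
    1, and a coordinate of 2 or more would add at least [1 / c i >= 1 / m], leaving nothing for the
    origin. *)
Lemma T_in_S1 : in_S1 R (T_simplex d l).
Proof.
have cR i : 0 < (c i)%:R :> R by rewrite ltr0n T_coef_gt0.
have mR : 0 < m%:R :> R by rewrite ltr0n T_tail_gt0.
split; first exact: T_affinely_independent.
exists (const_mx 1); split.
  pose lam u : R := if unlift ord0 u is Some i then (c (i : 'I_d))%:R^-1 else m%:R^-1.
  have -> : toR R (const_mx 1) = \sum_u lam u *: toR R (T_simplex d l u).
    by apply/rowP => i; rewrite T_combination /lam liftK mulVf ?gt_eqF // !mxE.
  apply: pos_interior; first exact: T_affinely_independent.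
    by move=> u; rewrite /lam; case: unlift => [i|]; rewrite invr_gt0.
  rewrite big_ord_recl {1}/lam unlift_none addrC -[RHS]sum_Tbary; congr (_ + _).
  by apply: eq_bigr => i _; rewrite /lam liftK.
move=> z /(interior_pos T_affinely_independent)[lam [l0 l1 lz]].
have zE i : (z 0 i)%:~R = lam (lift ord0 i) * (c i)%:R.
  by have /rowP/(_ i) := lz; rewrite T_combination mxE.
have z1 i : 1 <= z 0 i.
  by rewrite -gtz0_ge1 -(ltr0z R) zE mulr_gt0.
apply/rowP => i; rewrite mxE; apply/eqP; rewrite eq_le z1 /= leNgt; apply/negP => z2.
have lamE j : lam (lift ord0 j) = (z 0 j)%:~R / (c j)%:R by rewrite zE mulfK ?gt_eqF.
have : 1 <= \sum_(j < d) lam (lift ord0 j).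
  rewrite -sum_Tbary (bigD1 i) //= [leRHS](bigD1 i) //= addrAC; apply: lerD.
    rewrite lamE; apply: (@le_trans _ _ (2 / (c i)%:R)).
      rewrite mulr_natl mulr2n lerD2l lef_pV2 ?posrE //.
      by rewrite ler_nat T_coef_le.
    have : 2%:Z <= z 0 i by lia.
    by rewrite -(ler_int R) => z2'; rewrite ler_wpM2r ?invr_ge0 ?(ltW (cR i)).
  apply: ler_sum => j _; rewrite lamE ler_peMl ?invr_ge0 ?(ltW (cR j)) //.
  by have := z1 j; rewrite -(ler_int R).
have := l1; rewrite big_ord_recl => e; have := l0 ord0; lra.
Qed.

(** Seen from [t], the origin or a vertex with coefficient [m], the edge to [lift ord0 q] is
    divisible by [c q], because [c q] divides [m]. So the edge matrix factors through the diagonal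
    matrix of the [c q]. *)
Lemma volZ_T_ge (Q : {set 'I_d}) (t : 'I_d.+1) :
    t \notin lift ord0 @: Q -> (forall i, t = lift ord0 i -> (k <= i)%N) ->
  (\prod_(i in Q) c i)%:R / (#|Q|)`!%:R
    <= volZ R (face_pts (T_simplex d l) (t |: lift ord0 @: Q)).
Proof.
move=> tQ tk; set G := t |: _; set s := face_pts _ _.
have tG : t \in G by rewrite !inE eqxx.
have eQ : (size s).-1 = #|Q|.
  by rewrite size_face_pts cardsU1 tQ card_imset //; apply: lift_inj.
pose f (j : 'I_(size s).-1) : 'I_d := enum_val (cast_ord eQ j).
have f_inj : injective f by move=> i j /enum_val_inj/cast_ord_inj.
have f_surj i : i \in Q -> exists j, i = f j.
  move=> iQ; exists (cast_ord (esym eQ) (enum_rank_in iQ i)).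
  by rewrite /f cast_ordKV enum_rankK_in.
have fQ j : f j \in Q by apply: enum_valP.
pose C : 'M[int]_((size s).-1, d) := \matrix_(j, i)
  ((i == f j)%:Z - (t == lift ord0 i)%:Z * (m %/ c (f j))%:Z).
have TC u : u \in G -> T_simplex d l u - T_simplex d l t =
    \sum_j ((u == lift ord0 (f j))%:Z * (c (f j))%:Z) *: row j C.
  rewrite !inE => /predU1P[->|/imsetP[q qQ ->]].
    rewrite subrr big1 // => j _; case: eqP => [e|_]; last by rewrite mul0r scale0r.
    by move/negP: tQ; case; rewrite e imset_f.
  have [j0 ->] := f_surj q qQ.
  rewrite (bigD1 j0) //= eqxx big1 => [|j jj]; last first.
    rewrite (inj_eq (@lift_inj _ ord0)) (inj_eq f_inj) eq_sym (negbTE jj).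
    by rewrite mul0r scale0r.
  apply/rowP => i; rewrite addr0 mul1r 2!mxE !T_simplexE [RHS]mxE 2!mxE.
  rewrite (inj_eq (@lift_inj _ ord0)) mulrBr; congr (_ - _).
    by rewrite [in RHS]eq_sym; case: eqP => [->|_]; rewrite ?mul1r ?mul0r ?mulr1 ?mulr0.
  case: eqP => [/tk ti|_]; last by rewrite !mul0r mulr0.
  by rewrite !mul1r -PoszM mulnC divnK ?T_coef_dvd // T_coef_tail.
(* [C'] moves the base vertex from [t] to the first vertex in the enumeration of the face. *)
pose C' : 'M[int]_((size s).-1) := \matrix_(j, i)
  ((nth t (enum G) j.+1 == lift ord0 (f i))%:Z - (nth t (enum G) 0 == lift ord0 (f i))%:Z).
have eE : int_edge_mx s = C' *m diag_mx (\row_i (c (f i))%:Z) *m C.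
  apply/row_matrixP => j; rewrite (row_int_edge_mx tG).
  have shift (x y z : 'rV[int]_d) : x - y = (x - z) - (y - z).
    by rewrite opprB addrA subrK.
  have e0 : nth t (enum G) 0 \in G by apply: face_vertex_in; apply: card_face_gt0 tG.
  have ej : nth t (enum G) j.+1 \in G by apply: face_vertex_in; apply: (ltn_face (v := T_simplex d l) tG).
  rewrite (shift _ _ (T_simplex d l t)) !TC //.
  rewrite row_mul mulmx_sum_row -sumrB; apply: eq_bigr => i _.
  by rewrite -scalerBl -mulrBl; congr (_ *: _); rewrite mul_mx_diag !mxE.
have fE := face_row_free T_affinely_independent tG.
have fE' := fE; rewrite edge_mxE in fE'.
apply: le_trans (volZ_ge fE eE); rewrite -eQ ler_wpM2r ?invr_ge0 ?ler0n // ler_nat.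
have := det_factor_neq0 fE' eE; rewrite det_mulmx mulf_eq0 negb_or => /andP[d0 _].
rewrite abszM det_diag (big_morph absz abszM (erefl _)) /=.
have -> : (\prod_(i in Q) c i = \prod_j `|(\row_i (c (f i))%:Z) ord0 j|)%N.
  have bij : bijective (cast_ord eQ).
    by exists (cast_ord (esym eQ)) => i; rewrite ?cast_ordK ?cast_ordKV.
  rewrite big_enum_val (reindex _ (onW_bij _ bij)) /=.
  by apply: eq_bigr => j _; rewrite mxE.
by rewrite leq_pmull // absz_gt0.
Qed.

(** Every face [A] with [h + 1] vertices has a base vertex fit for [volZ_T_ge]: the origin, or else
    a tail vertex, since only [k < h] nonzero vertices lie before the tail. The other [g] vertices
    come from [top_subset_prod]. *)
Lemma T_gamma_ge g h : (g <= h)%N -> (k < h)%N -> (h <= d)%N ->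
  (\prod_(h - g <= i < h) c i)%:R / g`!%:R <= gamma R h g (T_simplex d l).
Proof.
move=> lgh lkh lhd.
suff H (A : {set 'I_d.+1}) : #|A| = h.+1 ->
    (\prod_(h - g <= i < h) c i)%:R / g`!%:R <= max_sub R g (T_simplex d l) A.
  apply: le_bigmin => [|A /eqP]; last exact: H.
  apply: H; rewrite -[RHS](card_ord_lt (N := d.+1)) ?ltnS //.
  by apply: eq_card => i; rewrite !inE ltnS.
move=> cA.
pose Q1 := [set i : 'I_d | lift ord0 i \in A].
have Q1A : lift ord0 @: Q1 = A :\ ord0.
  apply/setP => u; rewrite !inE; apply/imsetP/andP => [[i]|[u0 uA]].
    by rewrite inE => iA ->; rewrite eq_sym neq_lift.
  by case: (unliftP ord0 u) u0 uA => [i ->|->//] _ iA; exists i; rewrite ?inE.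
have cQ1 : #|Q1| = #|A :\ ord0| by rewrite -Q1A card_imset //; apply: lift_inj.
have [t [Q0 [tA cQ0 Q0A tQ0 tk]]] : exists t (Q0 : {set 'I_d}),
    [/\ t \in A, #|Q0| = h, forall i, i \in Q0 -> lift ord0 i \in A,
        t \notin lift ord0 @: Q0 & forall i, t = lift ord0 i -> (k <= i)%N].
  have [A0|A0] := boolP (ord0 \in A).
    exists ord0, Q1; split=> //.
    - by move: cA; rewrite (cardsD1 ord0) A0 -cQ1 => -[].
    - by move=> i; rewrite inE.
    by rewrite Q1A !inE eqxx.
  have cQ1' : #|Q1| = h.+1 by rewrite cQ1 -cA [in RHS](cardsD1 ord0) (negbTE A0).
  have /exists_inP[i iQ ki] : [exists i in Q1, (k <= i)%N].
    apply: contraT => /exists_inPn H; suff : (#|Q1| <= k)%N by lia.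
    rewrite -(card_ord_lt (ltnW lkd)); apply/subset_leq_card/subsetP => i /H.
    by rewrite inE ltnNge.
  exists (lift ord0 i), (Q1 :\ i); split.
  - by rewrite inE in iQ.
  - by move: cQ1'; rewrite (cardsD1 i) iQ => -[].
  - by move=> j; rewrite !inE => /andP[].
  - by rewrite (mem_imset _ _ (@lift_inj _ ord0)) !inE eqxx.
  by move=> j /lift_inj <-.
have [|Q /andP[QQ0 /eqP cQ] le] := top_subset_prod T_coef_inc (g := g) (Q := Q0).
  by rewrite cQ0.
have tQ : t \notin lift ord0 @: Q.
  by apply: contra tQ0; apply/subsetP/imsetS.
apply: le_trans (_ : volZ R (face_pts (T_simplex d l) (t |: lift ord0 @: Q)) <= _).
  apply: le_trans (volZ_T_ge tQ tk); rewrite cQ ler_wpM2r ?invr_ge0 ?ler0n // ler_nat.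
  by rewrite cQ0 in le.
apply: (bigmax_sup (t |: lift ord0 @: Q)) => //.
rewrite cardsU1 tQ card_imset ?cQ ?eqxx ?andbT; last exact: lift_inj.
rewrite subUset sub1set tA; apply/subsetP => _ /imsetP[i iQ ->].
by apply/Q0A/(subsetP QQ0).
Qed.
End TSimplex.

(** * The upper bound for [gamma] *)

(** As [f] decreases, the largest index in [A] may be raised to [h - 1]; the other indices are
    smaller, hence below [h - 1], and induction applies. *)
Lemma low_prod_le (F : realFieldType) (T : finType) (idx : T -> nat) (f : nat -> F) :
    injective idx -> (forall i, 0 <= f i) ->
    (forall i j, (i <= j)%N -> f j <= f i) ->
  forall (A : {set T}) h, (forall i, i \in A -> (idx i < h)%N) ->
  \prod_(h - #|A| <= i < h) f i <= \prod_(i in A) f (idx i).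
Proof.
move=> idx_inj f0 fdec A; move: {2}#|A| (erefl #|A|) => n.
elim: n A => [|n IHn] A cA h ltA.
  by rewrite (cards0_eq cA) cards0 subn0 big_geq // big_set0.
have [x0 x0A] : exists x, x \in A by apply/card_gt0P; rewrite cA.
case: (arg_maxnP idx x0A) => x xA xmax.
have cAx : #|A :\ x| = n by move: cA; rewrite (cardsD1 x) [x \in A]xA => -[].
have xh := ltA x xA; case: h ltA xh => // h ltA xh.
rewrite (bigD1 x) //= cA subSS big_nat_recr /=; last exact: leq_subr.
rewrite mulrC; apply: ler_pM => //; first by apply: prodr_ge0.
  exact: fdec.
rewrite -cAx (eq_bigl (mem (A :\ x))) => [|i]; last by rewrite !inE andbC.
apply: IHn => // i; rewrite !inE => /andP[ix iA].
have : (idx i <= idx x)%N by apply: xmax.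
rewrite leq_eqVlt => /predU1P[/idx_inj e|lt]; first by rewrite e eqxx in ix.
exact: leq_trans lt _.
Qed.

Section GammaUpperBound.
Variables (R : rcfType) (d g h : nat) (v : 'I_d.+1 -> 'rV[int]_d).
Hypothesis v_S1 : in_S1 R v.
Hypothesis g_gt0 : (0 < g)%N.
Hypothesis lt_gh : (g < h)%N.
Hypothesis lt_hd : (h < d)%N.

Lemma gamma_le_T : exists2 l, (1 <= l <= h)%N &
  gamma R h g v <= (\prod_(h - g <= i < h) T_coef d l i.+1)%:R / g`!%:R.
Proof.
have [free_v _] := v_S1; have [b [D [p bD]]] := S1_bary_data v_S1.
have D0 : 0 < D%:R :> R by rewrite ltr0n (bary_denom_gt0 bD).
pose s := sort (fun i j => b j <= b i)%N (enum 'I_d.+1).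
have perm_s : perm_eq s (enum 'I_d.+1) by rewrite perm_sort.
have uniq_s : uniq s by rewrite (perm_uniq perm_s) enum_uniq.
have size_s : size s = d.+1 by rewrite (perm_size perm_s) size_enum_ord.
have mem_s i : i \in s by rewrite (perm_mem perm_s) mem_enum.
pose f n := nth ord0 s n.
have fK i : f (index i s) = i by apply: nth_index.
have idx_lt i : (index i s < d.+1)%N by have := index_mem i s; rewrite mem_s size_s.
have idx_inj : injective (index^~ s) by move=> i j e; rewrite -(fK i) e fK.
have fI n : (n < d.+1)%N -> index (f n) s = n by move=> ln; rewrite index_uniq ?size_s.
(* the padding past [d] keeps [x] nonincreasing *)
pose x n : R := if (n <= d)%N then (b (f n))%:R / D%:R else 0.
have x_ge0 n : 0 <= x n by rewrite /x; case: ifP => // _; rewrite divr_ge0 // ltW.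
have x_gt0 n : (n <= d)%N -> 0 < x n.
  by move=> ln; rewrite /x ln divr_gt0 // ltr0n (bary_gt0 bD).
have x_dec i j : (i <= j)%N -> x j <= x i.
  move=> lij; rewrite {1}/x; case: leqP => // ljd; rewrite /x (leq_trans lij ljd).
  rewrite ler_wpM2r ?invr_ge0 ?(ltW D0) // ler_nat.
  apply: (sorted_leq_nth (leT := fun i j => (b j <= b i)%N)) => //.
  - by move=> u v' w /= h1 h2; apply: leq_trans h2 h1.
  - by apply: sort_sorted => u w; apply: leq_total.
  - by rewrite inE size_s ltnS (leq_trans lij).
  by rewrite inE size_s ltnS.
have big_s (S : Type) (idx0 : S) (op : Monoid.com_law idx0) (F : 'I_d.+1 -> S) :
    \big[op/idx0]_i F i = \big[op/idx0]_(0 <= n < d.+1) F (f n).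
  by rewrite -big_enum /= -(perm_big _ perm_s) (big_nth ord0) size_s.
have x_sum1 : \sum_(0 <= n < d.+1) x n = 1.
  rewrite (eq_big_nat _ _ (F2 := fun n => (b (f n))%:R / D%:R)); last first.
    by move=> n /andP[_ ln]; rewrite /x -ltnS ln.
  rewrite -(big_s _ _ _ (fun i => (b i)%:R / D%:R)) -mulr_suml -natr_sum.
  by rewrite (bary_sum bD) divff // gt_eqF.
pose J j := [set i | (index i s < j)%N].
have big_J (S : Type) (idx0 : S) (op : Monoid.com_law idx0) j (F : 'I_d.+1 -> S) :
    (j <= d.+1)%N ->
    \big[op/idx0]_(i in J j) F i = \big[op/idx0]_(0 <= n < j) F (f n).
  move=> lj; rewrite big_mkcond big_s (big_cat_nat (n := j)) //=.
  rewrite [X in op _ X]big_nat [X in op _ X]big1 ?Monoid.mulm1; last first.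
    by move=> n /andP[ljn ln]; rewrite inE fI // ltnNge ljn.
  by apply: eq_big_nat => n /andP[_ ln]; rewrite inE fI ?ln //; apply: leq_trans lj.
have card_J j : (j <= d.+1)%N -> #|J j| = j.
  by move=> lj; rewrite -sum1_card big_J // sum_nat_const_nat subn0 muln1.
have prod_le_sum j : (j <= d)%N ->
    \prod_(0 <= i < j) x i <= \sum_(j <= i < d.+1) x i.
  move=> ljd; have ljd' := leqW ljd.
  have JT : J j != setT.
    by apply/eqP => /(congr1 (fun A : {set _} => #|A|)); rewrite card_J // cardsT card_ord; lia.
  have := bary_prod_le_sum bD JT; rewrite card_J // big_J // -(ler_nat R).
  rewrite !natrM natrX natr_prod.
  have -> : (\sum_(i in ~: J j) b i)%:R = D%:R * \sum_(j <= i < d.+1) x i :> R.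
    have := x_sum1; rewrite (big_cat_nat (n := j)) //= => /(canRL (addKr _)) ->.
    rewrite mulrDr mulr1 mulrN addrC; apply/(canRL (addrK _)).
    rewrite -[X in _ = X%:R](bary_sum bD) [in RHS](bigID (mem (J j))) /= natrD addrC.
    congr (_ + _); last first.
      by congr _%:R; apply: eq_bigl => i; rewrite inE.
    rewrite big_J // natr_sum mulr_sumr; apply: eq_big_nat => n /andP[_ ln].
    by rewrite /x -ltnS (leq_trans ln) // mulrCA divff ?mulr1 ?gt_eqF.
  have -> : \prod_(0 <= i < j) (b (f i))%:R = D%:R ^+ j * \prod_(0 <= i < j) x i.
    rewrite [LHS](eq_big_nat _ _ (F2 := fun i => D%:R * x i)).
      by rewrite big_split /= prodr_const_nat subn0.
    move=> n /andP[_ ln]; rewrite /x -ltnS (leq_trans ln) //.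
    by rewrite mulrCA divff ?mulr1 ?gt_eqF.
  by rewrite mulrCA !ler_pM2l // exprn_gt0.
have [l lh Tle] := exists_Tbary_prod_le x_gt0 (fun i j ij => x_dec i j (proj1 (andP ij)))
  x_sum1 prod_le_sum (a := h - g) (h := h) ltac:(lia) lt_hd.
exists l => //.
set V := (_ / _).
have V0 : 0 <= V by rewrite divr_ge0.
have cH : #|J h.+1| == h.+1 by rewrite card_J //; lia.
rewrite /gamma; apply: (bigmin_inf (J h.+1)) => //.
apply: bigmax_le => // B /andP[BH /eqP cB].
have [k0 k0B] : exists k, k \in B by apply/card_gt0P; rewrite cB.
(* Omitting the vertex of [B] that comes last in the order leaves vertices of index below [h], as
   [low_prod_le] requires. *)
case: (arg_maxnP (index^~ s) k0B) => k kB kmax.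
have := volZ_face_le free_v bD kB; rewrite cB /= => vol.
have cBk : #|B :\ k| = g by move: cB; rewrite (cardsD1 k) [k \in B]kB => -[].
have lowB : \prod_(h - g <= i < h) x i <= \prod_(i in B :\ k) ((b i)%:R / D%:R).
  have := low_prod_le idx_inj x_ge0 x_dec (A := B :\ k) (h := h).
  rewrite cBk => H; apply: le_trans (H _) _.
    move=> i; rewrite !inE => /andP[ik iB].
    have : (index i s <= index k s)%N by apply: kmax.
    rewrite leq_eqVlt => /predU1P[/idx_inj e|lt]; first by rewrite e eqxx in ik.
    by apply: leq_trans lt _; have /(subsetP BH) := kB; rewrite inE ltnS.
  by rewrite le_eqVlt; apply/orP; left; apply/eqP/eq_bigr => i _; rewrite /x -ltnS idx_lt fK.
have [vol_le0|vol_gt0] := leP (volZ R (face_pts v B)) 0; first exact: le_trans vol_le0 V0.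
have T0 : 0 < (\prod_(h - g <= i < h) T_coef d l i.+1)%:R :> R.
  rewrite ltr0n prodn_gt0 // => i.
  by have := @T_coef_gt0 d l.-1 _ i; rewrite prednK; [apply; lia | lia].
rewrite /V mulrC -ler_pdivrMr //; apply: le_trans vol.
rewrite ler_pM2l //; apply: le_trans lowB; apply: le_trans Tle.
by rewrite prodfV natr_prod.
Qed.
End GammaUpperBound.


(** * Choice of [l] *)

Section LargeIndex.
Local Open Scope R_scope.

Lemma INR_exp2 n : INR (2 ^ n)%N = pow 2 n.
Proof. by elim: n => //= n IHn; rewrite expnS -multE mult_INR IHn. Qed.

(** With [Y = log2 (e (d + 1))], lying above the threshold means [Y < 2 ^ (l - 2)]. Then [s_l - 1 >=
    2 ^ (2 ^ (l - 2)) > 2 ^ Y = e (d + 1) >= 2 (d + 1)]. *)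
Lemma large_index_sylv d l : (0 < l)%N -> ~ small_index d l ->
  (2 * d.+1 <= (sylv l).-1)%N.
Proof.
move=> l0 nsmall.
have ltl : 2 + log2R (log2R (exp 1) + log2R (INR d + 1)) < INR l.
  by apply: Rnot_le_lt => le; apply: nsmall.
have L0 : 0 < ln 2 by rewrite -ln_1; apply: ln_increasing; Lra.lra.
have e2 : 2 < exp 1 by have := exp_ineq1 1; Lra.lra.
have L1 : ln 2 < 1 by rewrite -[X in _ < X]ln_exp; apply: ln_increasing; Lra.lra.
have d1 : 0 < INR d + 1 by have := pos_INR d; Lra.lra.
have ld0 : 0 <= ln (INR d + 1).
  rewrite -ln_1; case: (Req_dec (INR d) 0) => [->|dn]; first by rewrite Rplus_0_l; right.
  by left; apply: ln_increasing; have := pos_INR d; Lra.lra.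
move: ltl; rewrite /log2R ln_exp; set Y := _ / _ + _ / _ => ltl.
have YE : Y * ln 2 = 1 + ln (INR d + 1) 
  by rewrite /Y /Rdiv Rmult_plus_distr_r !Rmult_assoc Rinv_l ?Rmult_1_r ?Rmult_1_l; Lra.lra.
have Y1 : 1 < Y.
  by apply: (Rmult_lt_reg_r (ln 2)) => //; rewrite YE; Lra.lra.
have lY0 : 0 < ln Y by rewrite -ln_1; apply: ln_increasing; Lra.lra.
have q0 : 0 < ln Y / ln 2 by apply: Rdiv_lt_0_compat.
have {l0} : (2 < l)%N by apply/ssrnat.ltP; apply: INR_lt; rewrite [INR 2]/=; Lra.lra.
case: l nsmall ltl => [|[|n]] // _ ltl _; apply: leq_trans (sylv_double_exp n).
have Yn : Y < INR (2 ^ n)%N.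
  rewrite INR_exp2 -Rpower_pow; last by Lra.lra.
  rewrite -[X in X < _](exp_ln Y); last by Lra.lra.
  apply: exp_increasing; apply: (Rmult_lt_reg_r (/ ln 2)); first exact: Rinv_0_lt_compat.
  have -> : INR n * ln 2 * / ln 2 = INR n by rewrite Rmult_assoc Rinv_r ?Rmult_1_r; Lra.lra.
  by move: ltl; rewrite !S_INR /Rdiv; Lra.lra.
apply/ssrnat.leP; apply: INR_le; rewrite INR_exp2 -Rpower_pow; last by Lra.lra.
rewrite -multE mult_INR [INR d.+1]S_INR [INR 2]/=.
apply: (Rle_trans _ (exp (1 + ln (INR d + 1)))).
  by rewrite exp_plus exp_ln //; apply: Rmult_le_compat_r; Lra.lra.
left; apply: exp_increasing; rewrite -YE.
exact: Rmult_lt_compat_r.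
Qed.
End LargeIndex.

(** Write [l = k + 1], [n = d - k]. Only at index [k] can the coefficient drop, from
    [(n + 1) (s - 1)] to [s]; afterwards it grows from [(n + 1) (s - 1)] to [n (s - 1) s]. If [k]
    occurs in the product, the gain at the last index [h - 1] pays for the loss, because
    [(n + 1)^2 <= n (s - 1)]. *)
Lemma T_prod_step d g h l : (0 < l)%N -> (l < h)%N -> (h < d)%N ->
    (2 * d.+1 <= (sylv l).-1)%N ->
  (\prod_(h - g <= i < h) T_coef d l i.+1 <= \prod_(h - g <= i < h) T_coef d l.+1 i.+1)%N.
Proof.
case: l => // k _ lkh lhd large.
pose s := sylv k.+1; pose n := (d - k)%N.
have n2 : (2 <= n)%N by rewrite /n; lia.
have sn : (2 * n.+1 <= s.-1)%N by apply: leq_trans large; rewrite /n; lia.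
have tail i : (k <= i)%N -> T_coef d k.+1 i.+1 = (n.+1 * s.-1)%N.
  by move=> lki; rewrite /T_coef ltnS ltnNge lki /= /n -subSn ?subSS ?subn1 //; lia.
have tail' i : (k < i)%N -> T_coef d k.+2 i.+1 = (n * (s.-1 * s))%N.
  by move=> lki; rewrite /T_coef !ltnS leqNgt lki /= subn1 sylvSS.
have le_tail i : (k < i)%N -> (T_coef d k.+1 i.+1 <= T_coef d k.+2 i.+1)%N.
  move=> lki; rewrite tail ?(ltnW lki) // tail' // mulnA mulnAC leq_mul2r; nia.
case: (ltnP k (h - g)) => lka.
  by rewrite big_nat [X in (_ <= X)%N]big_nat; apply: leq_prod => i /andP[lai _]; apply: le_tail; lia.
case: h lkh lhd lka => // h lkh lhd lka.
rewrite (big_cat_nat (n := k)) //=; last by lia.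
rewrite [X in (_ <= X)%N](big_cat_nat (n := k)) //=; last by lia.
apply: leq_mul.
  rewrite big_nat [X in (_ <= X)%N]big_nat; apply: leq_prod => i /andP[_ lik].
  by rewrite /T_coef !ltnS lik (ltnW lik).
rewrite big_ltn; last by lia.
rewrite [X in (_ <= X)%N]big_ltn; last by lia.
rewrite big_nat_recr //= [X in (_ <= _ * X)%N]big_nat_recr //= !mulnA.
rewrite [X in (X <= _)%N]mulnAC [X in (_ <= X)%N]mulnAC; apply: leq_mul; last first.
  by rewrite big_nat [X in (_ <= X)%N]big_nat; apply: leq_prod => i /andP[lki _]; apply: le_tail.
have -> : T_coef d k.+2 k.+1 = s by rewrite /T_coef ltnS leqnn.
have lkh' : (k < h)%N by [].
rewrite !tail ?tail' ?(ltnW lkh') // mulnACA.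
have nr : (n.+1 * n.+1 <= n * s.-1)%N by nia.
apply: leq_trans (leq_mul nr (leqnn _)) _; nia.
Qed.

Unset Implicit Arguments.

Theorem mainTheorem4 (R : rcfType) (d g h : nat) :
  (4 <= d)%N -> (1 <= g)%N -> (g < h)%N -> (h <= d.-1)%N ->
  exists l : nat,
    (small_index d l \/ l = h) /\ (1 <= l <= d.+1)%N /\
    in_S1 R (T_simplex d l) /\
    (forall v : 'I_d.+1 -> 'rV[int]_d,
        in_S1 R v -> gamma R h g v <= gamma R h g (T_simplex d l)).
Proof.
move=> d4 g1 lt_gh le_hd; have lt_hd : (h < d)%N by lia.
(* Up to the factor [g!], [V l] bounds [gamma] of [T_l] from below for each [1 <= l <= h], and the
   largest [V l] bounds every [gamma] from above. *)
pose V l := (\prod_(h - g <= i < h) T_coef d l i.+1)%N.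
pose best l := (0 < l <= h)%N && [forall k : 'I_h, (V k.+1 <= V l)%N].
have ex_best : exists l, best l.
  have h0 : (0 < h)%N by lia.
  case: (arg_maxnP (fun k : 'I_h => V k.+1) (erefl (xpredT (Ordinal h0)))) => k _ kmax.
  by exists k.+1; rewrite /best /= ltn_ord; apply/forallP => j; apply: kmax.
have best_le l : best l -> (l <= h)%N by case/andP => /andP[].
(* The largest maximizer of [V] is taken: if it were neither small nor [h], [T_prod_step] would make
   [l + 1] a maximizer too. *)
case: (ex_maxnP ex_best best_le) => l /andP[/andP[l0 lh] /forallP lbest] lmax.
have Vle l' : (0 < l' <= h)%N -> (V l' <= V l)%N.
  by case: l' => // k /andP[_ lkh]; apply: (lbest (Ordinal lkh)).
exists l; split; last split; [|by lia|].
  have [|lth|] := ltngtP l h; [|by lia|by right].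
  move=> llh; left; case: (Classical_Prop.classic (small_index d l)) => // nsmall.
  have := T_prod_step g l0 llh lt_hd (large_index_sylv l0 nsmall) => step.
  suff : (l.+1 <= l)%N by rewrite ltnn.
  apply: lmax; rewrite /best /= llh; apply/forallP => k.
  exact: leq_trans (lbest k) step.
have el : l = l.-1.+1 by lia.
split=> [|v vS1]; first by rewrite el; apply: T_in_S1; lia.
have [l' lh' gle] := gamma_le_T vS1 g1 lt_gh lt_hd.
apply: le_trans gle _; rewrite el.
apply: (@le_trans _ _ ((V l)%:R / g`!%:R)).
  by rewrite ler_wpM2r ?invr_ge0 ?ler0n // ler_nat Vle.
by rewrite el; apply: T_gamma_ge; lia.
Qed.
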